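(* Consider the controlled particle in a box $\dot\psi=(A+u(t)B)\psi$ in $H=L^2((0,\pi),\mathbf C)$, where $A\psi=\frac{i}{2}\psi''$ with domain $H^2\cap H^1_0((0,\pi),\mathbf C)$ and $(B\psi)(x)=ix\psi(x)$. Let $N\ge 3$ be an integer, $T>0$, and let $u:[0,T]\to\mathbf R$ be a piecewise constant control. Let $\Upsilon^u_t$ be the propagator of this system and $X^u_{(N)}(t,s)$ the propagator of its Galerkin approximation of order $N$. Then, for every $t\in[0,T]$ and every $j\in\{1,2,3\}$, $$\|\pi_3\Upsilon^u_t(\phi_j)-\pi_3X^u_{(N)}(t,0)\phi_j\|\le\left(\int_0^T|u(\tau)|\,d\tau\right)\left(\|\pi_3B(\mathrm{Id}-\pi_N)\|+2\|B\|\sup_{\tau\in[0,T]}\|\pi_3X^u_{(N)}(\tau,0)-X^u_{(N)}(\tau,0)\pi_3\|\right).$$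
   Context: The Hilbert basis $(\phi_k)_{k\ge1}$ of $H$ consists of the normalized eigenfunctions $\phi_k(x)=\sqrt{2/\pi}\,\sin(kx)$ of $A$, with $A\phi_k=-\frac{i k^2}{2}\phi_k$. The operator $B$ is bounded and skew-adjoint on $H$; $\|B\|$ and the other operator norms are those induced by the norm of $H$. For a piecewise constant control $u$, $\Upsilon^u_t$ is the unitary propagator from time $0$ to time $t$, obtained by composing successively the unitary groups generated by $A+u_jB$ on the intervals where $u$ takes the constant value $u_j$. For $m\in\mathbf N$, the projection $\pi_m$ is $\pi_m\psi=\sum_{k\le m}\langle\phi_k,\psi\rangle\phi_k$. The Galerkin approximation of order $N$ is the system in $H$ given by $\dot x=(A^{(N)}+u(t)B^{(N)})x$ with $A^{(N)}=\pi_NA\pi_N$ and $B^{(N)}=\pi_NB\pi_N$, and $X^u_{(N)}(t,s)$ is its propagator, i.e. the operator on $H$ mapping $x(s)$ to $x(t)$. *)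

(* Defs.v *)
From HB Require Import structures.
From mathcomp Require Import all_boot all_order all_algebra.
From mathcomp Require Import complex.
From mathcomp Require Import all_classical all_reals all_analysis.

Set Implicit Arguments.
Unset Strict Implicit.
Unset Printing Implicit Defensive.

Import Order.TTheory GRing.Theory Num.Theory.
Import numFieldNormedType.Exports.

Local Open Scope classical_set_scope.
Local Open Scope ring_scope.
Local Open Scope complex_scope.
Local Open Scope quotient_scope.

Local Notation Re := complex.Re.
Local Notation Im := complex.Im.

(* Lebesgue measure on (0, pi). *)
Definition box_measure (R : realType) :
    {measure set (measurableTypeR R) -> \bar R} :=
  mrestr (@lebesgue_measure R) (measurable_itv `]0, pi[).

Section HilbertSpace.
Context (R : realType).
Local Notation T := (measurableTypeR R).
Local Notation mu := (box_measure R).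

Definition L2fun : {pred R -> R[i]} :=
  fun f => ((fun x : T => Re (f x)) \in Lfun mu 2%:E) &&
           ((fun x : T => Im (f x)) \in Lfun mu 2%:E).

Fact L2fun_submod : submod_closed L2fun.
Proof.
have l2 : (1 <= (2%:E : \bar R))%E by rewrite lee_fin ler1n.
have [L0 LA] := Lfun_submod_closed mu l2.
split=> [|a f g /andP[fr fi] /andP[gr gi]]; first by apply/andP; split.
apply/andP; split.
- rewrite (_ : (fun x : T => _) =
      Re a \*: (fun x : T => Re (f x)) +
      ((- Im a) \*: (fun x : T => Im (f x)) + (fun x : T => Re (g x)))).
    exact: LA fr (LA _ _ _ fi gr).
  apply/funext => x; rewrite !fctE/= /GRing.scale/=.
  by case: (f x) (g x) a => [? ?] [? ?] [? ?] /=; rewrite mulNr addrA.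
- rewrite (_ : (fun x : T => _) =
      Re a \*: (fun x : T => Im (f x)) +
      (Im a \*: (fun x : T => Re (f x)) + (fun x : T => Im (g x)))).
    exact: LA fi (LA _ _ _ fr gi).
  apply/funext => x; rewrite !fctE/= /GRing.scale/=.
  by case: (f x) (g x) a => [? ?] [? ?] [? ?] /=; rewrite addrA.
Qed.

HB.instance Definition _ := GRing.isSubmodClosed.Build _ _ L2fun L2fun_submod.

Record preH := PreH { preH_fun :> R -> R[i]; _ : preH_fun \in L2fun }.

HB.instance Definition _ := [isSub for preH_fun].
HB.instance Definition _ := [Choice of preH by <:].
HB.instance Definition _ := [SubChoice_isSubLmodule of preH by <:].

Definition ae0 : {pred preH} :=
  fun f => `[< {ae mu, forall x : T, f x = 0} >].

Fact ae0_submod : submod_closed ae0.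
Proof.
split=> [|a f g /asboolP f0 /asboolP g0]; apply/asboolP; first exact: aeW.
have F : Filter (almost_everywhere mu) by exact: ae_filter_ringOfSetsType.
have := @filterS2 _ _ F _ _ _ _ f0 g0; apply=> x fx gx.
by rewrite -[LHS]/(a * f x + g x) fx gx mulr0 addr0.
Qed.

HB.instance Definition _ := GRing.isSubmodClosed.Build _ _ ae0 ae0_submod.

(* L^2((0, pi), C): square-integrable functions modulo equality a.e. on
   (0, pi). *)
Definition Hbox : Type := Quotient.quot ae0.

HB.instance Definition _ := GRing.Zmodule.on Hbox.
HB.instance Definition _ := EqQuotient.on Hbox.

Definition scaleH (a : R[i]) (psi : Hbox) : Hbox := \pi_Hbox (a *: repr psi).

Lemma scaleH_pi a f : scaleH a (\pi_Hbox f) = \pi_Hbox (a *: f).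
Proof.
apply/eqP; rewrite -Quotient.idealrBE -scalerBr rpredZ//.
suff: repr (\pi_Hbox f) - f \in ae0 by [].
by rewrite Quotient.idealrBE reprK.
Qed.

Fact scaleHA a b psi : scaleH a (scaleH b psi) = scaleH (a * b) psi.
Proof.
elim/quotW: psi => f.
by rewrite (scaleH_pi b) (scaleH_pi a) (scaleH_pi (a * b)) scalerA.
Qed.

Fact scale1H : left_id 1 scaleH.
Proof. by elim/quotW=> f; rewrite scaleH_pi scale1r. Qed.

Fact scaleHDr : right_distributive scaleH +%R.
Proof.
have piD f g : \pi_Hbox f + \pi_Hbox g = \pi_Hbox (f + g).
  exact/esym/Quotient.pi_add.
move=> a; elim/quotW=> f; elim/quotW=> g.
by rewrite piD !(scaleH_pi a) scalerDr piD.
Qed.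

Fact scaleHDl psi : {morph scaleH^~ psi : a b / a + b}.
Proof.
move=> a b; elim/quotW: psi => f.
rewrite (scaleH_pi (a + b)) (scaleH_pi a) (scaleH_pi b) scalerDl.
exact: Quotient.pi_add.
Qed.

HB.instance Definition _ :=
  GRing.Zmodule_isLmodule.Build R[i] Hbox scaleHA scale1H scaleHDr scaleHDl.

(* The class of f; 0 when f is not square-integrable. *)
Definition toH (f : R -> R[i]) : Hbox := \pi_Hbox (insubd (0 : preH) f).

Definition funH (psi : Hbox) : R -> R[i] := repr psi.

Definition Cintegral (f : R -> R[i]) : R[i] :=
  (\int[mu]_x Re (f x)) +i* (\int[mu]_x Im (f x)).

(* The inner product is linear in its second argument. *)
Definition dotH (psi chi : Hbox) : R[i] :=
  Cintegral (fun x => (funH psi x)^* * funH chi x).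

Definition normH (psi : Hbox) : R := Num.sqrt (Re (dotH psi psi)).

(* With values in \bar R, so that an unbounded map has norm +oo. *)
Definition opnorm (L : Hbox -> Hbox) : \bar R :=
  ereal_sup [set (normH (L psi))%:E | psi in [set psi | normH psi <= 1]].

End HilbertSpace.

Section ParticleInABox.
Context (R : realType).
Local Notation H := (Hbox R).

Definition Cderivable (f : R -> R[i]) (x : R) :=
  derivable (fun y => Re (f y)) x 1 /\ derivable (fun y => Im (f y)) x 1.

Definition Cderiv (f : R -> R[i]) (x : R) : R[i] :=
  derive1 (fun y => Re (f y)) x +i* derive1 (fun y => Im (f y)) x.

(* C^1_c((0, pi), C), each function being extended by zero to R. The Sobolev
   spaces below are built from these test functions as in Brezis, Functional
   Analysis, Sobolev Spaces and Partial Differential Equations, chapter 8. *)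
Definition test_function (f : R -> R[i]) :=
  [/\ forall x, Cderivable f x,
      continuous (fun x => Re (Cderiv f x)),
      continuous (fun x => Im (Cderiv f x)) &
      exists a b : R, [/\ 0 < a, b < pi &
        forall x, ~~ (a <= x <= b) -> f x = 0]].

(* The conjugation that dotH puts on f is harmless, test functions being stable
   under conjugation. *)
Definition is_weak_derivative (psi chi : H) :=
  forall f, test_function f -> dotH (toH (Cderiv f)) psi = - dotH (toH f) chi.

Definition sobolevH1 : set H :=
  [set psi | exists chi, is_weak_derivative psi chi].

(* The weak derivative of psi (there is at most one); 0 outside H^1. *)
Definition wderiv (psi : H) : H := xget 0 [set chi | is_weak_derivative psi chi].

Definition norm_sobolevH1 (psi : H) : R :=
  Num.sqrt (normH psi ^+ 2 + normH (wderiv psi) ^+ 2).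

Definition sobolevH2 : set H :=
  [set psi | sobolevH1 psi /\ sobolevH1 (wderiv psi)].

(* The closure of C^1_c in H^1. *)
Definition sobolevH10 : set H :=
  [set psi | sobolevH1 psi /\ forall e : R, 0 < e ->
     exists2 f, test_function f & norm_sobolevH1 (psi - toH f) < e].

Definition domA : set H := sobolevH2 `&` sobolevH10.

(* (i/2) psi'', only meaningful on domA. *)
Definition opA (psi : H) : H := (0 +i* 2^-1) *: wderiv (wderiv psi).

Definition opB (psi : H) : H := toH (fun x => (0 +i* x) * funH psi x).

Definition phi (k : nat) : H :=
  toH (fun x => (Num.sqrt (2 / pi) * sin (k%:R * x))%:C).

Definition projH (m : nat) (psi : H) : H :=
  \sum_(1 <= k < m.+1) dotH (phi k) psi *: phi k.

Definition cvgH (I : Type) (f : I -> H) (F : set_system I) (l : H) :=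
  (fun i => normH (f i - l)) @ F --> (0 : R).

Definition unitary_group (U : R -> H -> H) :=
  [/\ forall t, linear (U t),
      forall t psi, normH (U t psi) = normH psi,
      forall psi, U 0 psi = psi,
      forall s t psi, U (s + t) psi = U s (U t psi) &
      forall psi, cvgH (U ^~ psi) (0 : R)^' psi].

(* U is the unitary group whose infinitesimal generator is exactly the operator
   G with domain D. *)
Definition generates (D : set H) (G : H -> H) (U : R -> H -> H) :=
  unitary_group U /\
  forall psi chi,
    cvgH (fun h => (h^-1)%:C *: (U h psi - psi)) (0 : R)^' chi <->
    D psi /\ chi = G psi.

(* u is constant on each open interval of a partition of [0, T]; its values at
   the partition points are arbitrary. *)
Definition piecewise_constant (T : R) (u : R -> R) :=
  exists2 s : seq R, itv_partition 0 T s &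
    forall i, (i < size s)%N -> exists v,
      forall x, nth 0 (0 :: s) i < x < nth 0 s i -> u x = v.

(* For a piecewise constant u, the last clause makes Y t, for t in [0, T], the
   successive composition of the groups generated by A + u_j B, run for the
   lengths of the intervals on which u = u_j. *)
Definition is_propagator (T : R) (u : R -> R) (Y : R -> H -> H) :=
  exists U : R -> R -> H -> H,
    [/\ forall v, generates domA (fun psi => opA psi + v%:C *: opB psi) (U v),
        forall psi, Y 0 psi = psi &
        forall s t v, 0 <= s -> s <= t -> t <= T ->
          (forall x, s < x < t -> u x = v) ->
          forall psi, Y t psi = U v (t - s) (Y s psi)].

Definition opAN (N : nat) (psi : H) : H := projH N (opA (projH N psi)).

Definition opBN (N : nat) (psi : H) : H := projH N (opB (projH N psi)).

(* x is continuous on [0, T] and satisfies x' = (A^(N) + u B^(N)) x away from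
   the jumps of u. *)
Definition galerkin_solution (N : nat) (T : R) (u : R -> R) (x : R -> H) :=
  (forall t, 0 <= t <= T -> cvgH x (within `[0, T] (nbhs t)) (x t)) /\
  (forall t, 0 < t < T -> (\forall s \near t, u s = u t) ->
     cvgH (fun h => (h^-1)%:C *: (x (t + h) - x t)) (0 : R)^'
       (opAN N (x t) + (u t)%:C *: opBN N (x t))).

Definition is_galerkin_propagator (N : nat) (T : R) (u : R -> R)
    (X : R -> R -> H -> H) :=
  forall s, 0 <= s <= T -> forall x0,
    X s s x0 = x0 /\ galerkin_solution N T u (fun t => X t s x0).

End ParticleInABox.

(* Main.v *)
Require Import Defs.
From mathcomp Require Import all_boot all_order all_algebra.
From mathcomp Require Import complex.
From mathcomp Require Import all_classical all_reals all_analysis.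
From mathcomp Require Import measurable_realfun ring lra.

(** Everything is measured through the real part rdot of the inner product.

Let Delta be the vector pi_3 (Ups_t phi_j - X(t,0) phi_j), whose norm is to be
bounded, and let y be the Galerkin solution that takes the value Delta at time
t. The generator A^(N) + u B^(N) is skew-adjoint, so the pairing of y with the
Galerkin solution X(.,0) phi_j is constant in time ([sol_rdot]). The curve y
stays in the span of phi_1, ..., phi_N ([sol_projH]), a subspace of the domain
of A on which A acts diagonally; hence, in the derivative of the pairing of y
with Ups_s phi_j, the contributions of A cancel and only
u(s) rdot (y s) (B (Id - pi_N) Ups_s phi_j) is left. Integrating from 0 to t
([pairing_le]) bounds the square of the norm of Delta by the integral of |u|
times any bound of rdot (y s) (B (Id - pi_N) psi) over unit vectors psi.

Such a bound comes from commuting pi_3 with the propagator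
([rdot_X_projH_le]). Put v = y(0), so that y(s) = X(s,0) v and, X(s,0) being a
linear isometry, v has the norm of Delta. Then
y(s) = pi_3 X(s,0) v - [pi_3, X(s,0)] v + X(s,0) (v - pi_3 v). The first term
moves pi_3 onto B (Id - pi_N) psi and produces the norm of pi_3 B (Id - pi_N).
The second is a commutator at time s. As X(t,0) v = Delta is fixed by pi_3, the
third has the norm of X(t,0) v - X(t,0) pi_3 v = [pi_3, X(t,0)] v. This gives
the two commutator terms, each paired with a vector of norm at most the norm of
B.

The orbit Ups_s phi_j is paired with a curve that lies in the domain of A, and the
group acts on that curve by its adjoint; this gives the derivative of the
pairing without a derivative of the orbit ([is_derive_rdot_orbit]).

What remains concerns the concrete operators. The phi_k are orthonormal by
explicit primitives ([phi_orthonormal]). That phi_k belongs to the domain of A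
with A phi_k = -i k^2/2 phi_k ([domA_phi], [opA_phi]) takes three facts on the
interval: a classical derivative is a weak derivative ([weak_derivative_C1]);
a weak derivative is unique ([weak_derivative_unique], from
[du_bois_reymond]), without which the one selected by the definition of A could
not be computed; and a C^1 function vanishing at both ends is an H^1 limit of
functions with compact support ([H10_C1]). *)

Set Implicit Arguments.
Unset Strict Implicit.
Unset Printing Implicit Defensive.

Import Order.TTheory GRing.Theory Num.Theory.
Import numFieldNormedType.Exports.

Local Open Scope classical_set_scope.
Local Open Scope ring_scope.
Local Open Scope complex_scope.
Local Open Scope quotient_scope.

Local Notation Re := complex.Re.
Local Notation Im := complex.Im.

(** * Lebesgue measure on the interval *)

Section BoxMeasure.
Context (R : realType).
Local Notation T := (measurableTypeR R).
Local Notation mu := (box_measure R).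
Local Notation leb := (@lebesgue_measure R).
Implicit Types f g : T -> R.

Lemma box_measureE (A : set T) : mu A = leb (A `&` `]0, pi[).
Proof. by []. Qed.

Lemma box_measure_fin : (mu setT < +oo)%E.
Proof.
by rewrite box_measureE setTI lebesgue_measure_itv/= lte_fin pi_gt0 -EFinD ltry.
Qed.

(** The complement of the interval is null for the restricted measure, and both
    measures agree on measurable subsets of the interval. *)
Lemma ge0_integral_box (f : T -> \bar R) : measurable_fun [set: T] f ->
  (forall x, 0 <= f x)%E ->
  (\int[mu]_x f x = \int[leb]_(x in `]0%R, pi[) f x)%E.
Proof.
move=> mf f0; set D : set T := [set` `]0%R, pi[].
have mD : measurable D by exact: measurable_itv.
have mCD : measurable (~` D) by exact: measurableC.
have e1 : mu (~` D) = 0%E by rewrite box_measureE setICl measure0.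
rewrite (ge0_negligible_integral mCD measurableT mf _ e1)// setTD setCK.
apply: eq_measure_integral => A mA AD.
rewrite [LHS]box_measureE; congr (leb _).
by apply/seteqP; split=> [x []//|x Ax]; split => //; exact: AD.
Qed.

Lemma integrable_box f : mu.-integrable setT (EFin \o f) ->
  leb.-integrable `]0, pi[ (EFin \o f).
Proof.
move=> /integrableP[mf fi]; apply/integrableP; split.
  exact: measurable_funS mf.
rewrite ge0_integral_box// in fi.
exact: measurableT_comp mf.
Qed.

Lemma integral_box f : mu.-integrable setT (EFin \o f) ->
  (\int[mu]_x f x = \int[leb]_(x in `]0%R, pi[) f x)%R.
Proof.
move=> /[dup] fi /integrableP[mf _]; rewrite /Rintegral; congr fine.
rewrite integralE [RHS]integralE; congr (_ - _)%E; apply: ge0_integral_box => //.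
  exact: measurable_funepos.
exact: measurable_funeneg.
Qed.

Lemma Lfun2_mul_integrable f g : f \in Lfun mu 2%:E -> g \in Lfun mu 2%:E ->
  mu.-integrable setT (EFin \o (f \* g)).
Proof. by move=> f2 g2; apply/Lfun1_integrable; exact: Lfun2_mul_Lfun1. Qed.

(** The bound is only asked for on the interval, outside of which the box
    measure vanishes; it serves both for bounded functions and for
    multiplication by x. *)
Lemma Lfun2_dominated f g (M : R) : measurable_fun [set: T] f ->
  g \in Lfun mu 2%:E ->
  (forall x, 0 < x < pi -> `|f x| <= M * `|g x|) -> f \in Lfun mu 2%:E.
Proof.
move=> mf g2 fg; have /integrableP[mg2 gfin] := Lfun2_integrable_sqr g2.
apply/andP; split; first by rewrite inE.
rewrite !inE/= /finite_norm unlock /Lnorm poweR_lty//.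
have mh : measurable_fun [set: T] (fun x => `|f x| `^ 2).
  apply: (@measurableT_comp _ _ _ _ _ _ (fun x : R => x `^ 2)) => //.
  exact/measurableT_comp.
apply: (@le_lt_trans _ _ (\int[mu]_x ((M ^+ 2)%:E * `|(EFin \o (fun x => g x ^+ 2)%R) x|))%E).
  apply: ae_ge0_le_integral => //.
  - by move=> x _ /=; rewrite lee_fin powR_ge0.
  - exact/measurable_EFinP.
  - by move=> x _; rewrite mule_ge0// lee_fin sqr_ge0.
  - by apply: measurable_funeM; exact: measurableT_comp.
  exists (~` [set` `]0%R, pi[]); split.
  - exact: measurableC.
  - by rewrite box_measureE setICl measure0.
  move=> x /= /not_implyP[_ h] xI; apply: h; move: xI; rewrite /= in_itv/= => xI.
  rewrite powR_mulrn// lee_fin normrX -exprMn lerXn2r// ?nnegrE//.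
    by rewrite (le_trans _ (fg x xI)).
  exact: fg.
rewrite ge0_integralZl ?lee_fin ?sqr_ge0//; last exact: measurableT_comp.
by rewrite lte_mul_pinfty// lee_fin sqr_ge0.
Qed.

Lemma Lfun2_bounded f (M : R) : measurable_fun [set: T] f ->
  (forall x, 0 < x < pi -> `|f x| <= M) -> f \in Lfun mu 2%:E.
Proof.
move=> mf fM; apply: (@Lfun2_dominated f (cst 1) M) => //; last first.
  by move=> x /fM; rewrite normr1 mulr1.
rewrite inE/=; apply/andP; split; rewrite inE//=.
rewrite /finite_norm unlock /Lnorm poweR_lty//=.
rewrite normr1 powR1 integral_cst// mul1e; exact: box_measure_fin.
Qed.

End BoxMeasure.

(** * The Hilbert space of the box *)

Section BoxSpace.
Context (R : realType).
Local Notation T := (measurableTypeR R).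
Local Notation mu := (box_measure R).
Local Notation H := (Hbox R).
Implicit Types (f g : T -> R[i]) (psi chi : H) (a : R[i]).

#[global] Instance box_ae_filter : Filter (almost_everywhere mu).
Proof. exact: ae_filter_ringOfSetsType. Qed.

Definition Cintegrable f :=
  mu.-integrable setT (EFin \o (fun x => Re (f x))) /\
  mu.-integrable setT (EFin \o (fun x => Im (f x))).

Lemma Rintegral_ae (h k : T -> R) : mu.-integrable setT (EFin \o h) ->
  mu.-integrable setT (EFin \o k) -> {ae mu, forall x, h x = k x} ->
  \int[mu]_x h x = \int[mu]_x k x.
Proof.
move=> ih ik hk; rewrite /Rintegral; congr fine.
apply: ae_eq_integral => //.
- exact: measurable_int ih.
- exact: measurable_int ik.
- by apply: filterS hk => x /= ->.
Qed.

Lemma Cintegral_ae f g : Cintegrable f -> Cintegrable g ->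
  {ae mu, forall x, f x = g x} -> Cintegral f = Cintegral g.
Proof.
move=> [fr fi] [gr gi] fg; congr (_ +i* _); apply: Rintegral_ae => //;
  by apply: filterS fg => x ->.
Qed.

Lemma CintegralD f g : Cintegrable f -> Cintegrable g ->
  Cintegral (fun x => f x + g x) = Cintegral f + Cintegral g.
Proof.
move=> [fr fi] [gr gi]; rewrite /Cintegral /= -[RHS]/(_ +i* _); congr (_ +i* _).
  rewrite -RintegralD//; apply: eq_Rintegral => x _.
  by case: (f x) (g x) => [? ?] [? ?].
rewrite -RintegralD//; apply: eq_Rintegral => x _.
by case: (f x) (g x) => [? ?] [? ?].
Qed.

Lemma CintegrableD f g : Cintegrable f -> Cintegrable g ->
  Cintegrable (fun x => f x + g x).
Proof.
move=> [fr fi] [gr gi]; split.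
  rewrite (_ : _ \o _ = (EFin \o (fun x => Re (f x))) \+ (EFin \o (fun x => Re (g x))))%E.
    exact: integrableD.
  by apply/funext => x /=; case: (f x) (g x) => [? ?] [? ?].
rewrite (_ : _ \o _ = (EFin \o (fun x => Im (f x))) \+ (EFin \o (fun x => Im (g x))))%E.
  exact: integrableD.
by apply/funext => x /=; case: (f x) (g x) => [? ?] [? ?].
Qed.

Lemma CintegrableZ a f : Cintegrable f -> Cintegrable (fun x => a * f x).
Proof.
case: a => a b [fr fi]; split.
  rewrite (_ : _ \o _ = (fun x => a%:E * (EFin \o (fun x => Re (f x))) x) \+
     (fun x => (- b)%:E * (EFin \o (fun x => Im (f x))) x))%E.
    by apply: integrableD => //; exact: integrableZl.
  by apply/funext => x /=; case: (f x) => [? ?] /=; rewrite -!EFinM -EFinD mulNr.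
rewrite (_ : _ \o _ = (fun x => a%:E * (EFin \o (fun x => Im (f x))) x) \+
   (fun x => b%:E * (EFin \o (fun x => Re (f x))) x))%E.
  by apply: integrableD => //; exact: integrableZl.
by apply/funext => x /=; case: (f x) => [? ?] /=; rewrite -!EFinM -EFinD.
Qed.

Lemma CintegralZ a f : Cintegrable f ->
  Cintegral (fun x => a * f x) = a * Cintegral f.
Proof.
move=> [fr fi]; have fr' b := integrableZl measurableT b fr.
have fi' b := integrableZl measurableT b fi.
case: a => a b; rewrite /Cintegral -[RHS]/(_ +i* _); congr (_ +i* _).
  rewrite -!RintegralZl// -RintegralB//; [|exact: fr'|exact: fi'].
  by apply: eq_Rintegral => x _; case: (f x) => [? ?].
rewrite -!RintegralZl// -RintegralD//; [|exact: fi'|exact: fr'].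
by apply: eq_Rintegral => x _; case: (f x) => [? ?].
Qed.

Lemma Cintegral_conj f : Cintegrable f ->
  Cintegral (fun x => (f x)^*) = (Cintegral f)^*.
Proof.
move=> [fr fi]; rewrite /Cintegral /=; congr (_ +i* _).
  by apply: eq_Rintegral => x _; case: (f x).
rewrite -mulN1r -RintegralZl//.
by apply: eq_Rintegral => x _; case: (f x) => [? ?]/=; rewrite mulN1r.
Qed.

Lemma Cintegrable_mul f g : f \in @L2fun R -> g \in @L2fun R ->
  Cintegrable (fun x => (f x)^* * g x).
Proof.
move=> /andP[fr fi] /andP[gr gi].
have I := Lfun2_mul_integrable.
split.
  rewrite (_ : _ \o _ = (fun x => (Re (f x) * Re (g x))%R%:E) \+
     (fun x => (Im (f x) * Im (g x))%R%:E))%E.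
    by apply: integrableD => //; exact: I.
  apply/funext => x /=; case: (f x) (g x) => [? ?] [? ?] /=.
  by rewrite -EFinD mulNr opprK.
rewrite (_ : _ \o _ = (fun x => (Re (f x) * Im (g x))%R%:E) \-
   (fun x => (Im (f x) * Re (g x))%R%:E))%E.
  by apply: integrableB => //; exact: I.
apply/funext => x /=; case: (f x) (g x) => [? ?] [? ?] /=.
by rewrite -EFinB mulNr.
Qed.

Lemma funH_L2 psi : funH psi \in @L2fun R.
Proof. by rewrite /funH; case: (repr psi). Qed.

(** The difference of the representatives is a null function, the kernel of the
    quotient. With [funH_pi_ae] this replaces the quotient by almost everywhere
    equality. *)
Lemma pi_ae (p q : preH R) : {ae mu, forall x, p x = q x} ->
  \pi_H p = \pi_H q :> H.
Proof.
move=> pq; apply/eqP; rewrite -Quotient.idealrBE; apply/asboolP.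
apply: filterS pq => x /= pq.
by rewrite -[LHS]/(p x - q x) pq subrr.
Qed.

Lemma funH_pi_ae (p : preH R) : {ae mu, forall x, funH (\pi_H p : H) x = p x}.
Proof.
have : repr (\pi_H p : H) - p \in @ae0 R by rewrite Quotient.idealrBE reprK.
move/asboolP; apply: filterS => x /= /eqP.
by rewrite -[X in X == _]/(funH (\pi_H p : H) x - p x) subr_eq0 => /eqP.
Qed.

Lemma funH_toH f : f \in @L2fun R -> {ae mu, forall x, funH (toH f) x = f x}.
Proof.
move=> f2; have := funH_pi_ae (insubd (0 : preH R) f).
apply: filterS => x; rewrite /toH => ->.
by rewrite -[LHS]/(val (insubd (0 : preH R) f) x) insubdK.
Qed.

Lemma toH_funH psi : toH (funH psi) = psi.
Proof. by rewrite /toH /funH valKd reprK. Qed.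

Lemma toH_ae f g : f \in @L2fun R -> g \in @L2fun R ->
  {ae mu, forall x, f x = g x} -> toH f = toH g.
Proof.
move=> f2 g2 fg; apply: pi_ae; apply: filterS fg => x fg.
rewrite -[LHS]/(val (insubd (0 : preH R) f) x).
by rewrite -[RHS]/(val (insubd (0 : preH R) g) x) !insubdK.
Qed.

Lemma funHD psi chi :
  {ae mu, forall x, funH (psi + chi) x = funH psi x + funH chi x}.
Proof.
have E : psi + chi = \pi_H (repr psi + repr chi).
  by rewrite Quotient.pi_add !reprK.
by rewrite E; exact: (funH_pi_ae (repr psi + repr chi)).
Qed.

Lemma funHZ a psi : {ae mu, forall x, funH (a *: psi) x = a * funH psi x}.
Proof.
have E : a *: psi = \pi_H (a *: repr psi) by rewrite -scaleH_pi reprK.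
by rewrite E; exact: (funH_pi_ae (a *: repr psi)).
Qed.

Lemma dotH_ae f g psi chi : f \in @L2fun R -> g \in @L2fun R ->
  {ae mu, forall x, funH psi x = f x} ->
  {ae mu, forall x, funH chi x = g x} ->
  dotH psi chi = Cintegral (fun x => (f x)^* * g x).
Proof.
move=> f2 g2 pf pg; apply: Cintegral_ae.
- exact: Cintegrable_mul (funH_L2 _) (funH_L2 _).
- exact: Cintegrable_mul.
- by apply: filterS2 pf pg => x -> ->.
Qed.

Lemma dotH_toH f g : f \in @L2fun R -> g \in @L2fun R ->
  dotH (toH f) (toH g) = Cintegral (fun x => (f x)^* * g x).
Proof. by move=> f2 g2; apply: dotH_ae => //; exact: funH_toH. Qed.

Lemma dotHPr psi a chi1 chi2 :
  dotH psi (a *: chi1 + chi2) = a * dotH psi chi1 + dotH psi chi2.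
Proof.
have I chi := Cintegrable_mul (funH_L2 psi) (funH_L2 chi).
rewrite /dotH -CintegralZ// -CintegralD//; last exact: CintegrableZ.
apply: Cintegral_ae => //; first by apply: CintegrableD => //; exact: CintegrableZ.
have := funHD (a *: chi1) chi2; have := funHZ a chi1.
by apply: filterS2 => x -> ->; rewrite mulrDr mulrCA.
Qed.

Lemma dotHC psi chi : dotH chi psi = conjc (dotH psi chi).
Proof.
rewrite /dotH -Cintegral_conj; last exact: Cintegrable_mul (funH_L2 _) (funH_L2 _).
congr Cintegral; apply/funext => x.
by case: (funH chi x) (funH psi x) => [? ?] [? ?]; simpc;
  congr (_ +i* _); ring.
Qed.

Lemma dotHE psi :
  Re (dotH psi psi) = \int[mu]_x ((Re (funH psi x)) ^+ 2 + (Im (funH psi x)) ^+ 2).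
Proof.
apply: eq_Rintegral => x _; case: (funH psi x) => [? ?] /=.
by rewrite mulNr opprK !expr2.
Qed.

Lemma dotH_ge0 psi : 0 <= Re (dotH psi psi).
Proof. by rewrite dotHE; apply: Rintegral_ge0 => x _; rewrite addr_ge0 ?sqr_ge0. Qed.

Lemma dotH_eq0 psi : Re (dotH psi psi) = 0 -> psi = 0.
Proof.
rewrite dotHE => psi0.
have /andP[pr pi] := funH_L2 psi.
have I : mu.-integrable setT
    (EFin \o (fun x => (Re (funH psi x)) ^+ 2 + (Im (funH psi x)) ^+ 2)).
  rewrite (_ : _ \o _ = (fun x => (Re (funH psi x) ^+ 2)%R%:E) \+
     (fun x => (Im (funH psi x) ^+ 2)%R%:E))%E//.
  by apply: integrableD => //; exact: Lfun2_integrable_sqr.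
have : (\int[mu]_x `|((Re (funH psi x)) ^+ 2 +
    (Im (funH psi x)) ^+ 2)%R%:E|)%E = 0%E.
  under eq_integral => x _ do rewrite /= ger0_norm ?addr_ge0 ?sqr_ge0//.
  rewrite -[LHS]fineK; last exact: (integrable_fin_num measurableT I).
  by rewrite -[X in X%:E]/(Rintegral _ _ _) psi0.
move/ae_eq_integral_abs => /(_ measurableT (measurable_int _ I)) h.
have -> : 0 = \pi_H (0 : preH R).
  apply: (@addrI _ (\pi_H (0 : preH R))).
  by rewrite addr0 -[in LHS](addr0 (0 : preH R)); exact: Quotient.pi_add.
rewrite -[LHS]reprK; apply: pi_ae; apply: filterS h => x /= /(_ Logic.I) [].
move=> e; change (funH psi x = 0); move: e.
move: (funH psi x) => [a b] /= /eqP.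
by rewrite paddr_eq0 ?sqr_ge0// !sqrf_eq0 => /andP[/eqP -> /eqP ->].
Qed.

(** The real inner product underlying the complex one. It has the same norm, and
    it is what pairs with derivatives in a real time variable. *)
Definition rdot psi chi : R := Re (dotH psi chi).

Lemma rdotC psi chi : rdot psi chi = rdot chi psi.
Proof. by rewrite /rdot dotHC; case: (dotH chi psi). Qed.

Lemma dotHDr psi chi1 chi2 :
  dotH psi (chi1 + chi2) = dotH psi chi1 + dotH psi chi2.
Proof. by rewrite -[chi1]scale1r dotHPr mul1r scale1r. Qed.

Lemma dotH0r psi : dotH psi 0 = 0.
Proof. by apply: (@addIr _ (dotH psi 0)); rewrite -dotHDr !add0r. Qed.

Lemma dotHZr psi a chi : dotH psi (a *: chi) = a * dotH psi chi.
Proof. by rewrite -[a *: chi]addr0 dotHPr dotH0r addr0. Qed.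

Lemma dotHNr psi chi : dotH psi (- chi) = - dotH psi chi.
Proof. by rewrite -scaleN1r dotHZr mulN1r. Qed.

Lemma dotHBr psi chi1 chi2 :
  dotH psi (chi1 - chi2) = dotH psi chi1 - dotH psi chi2.
Proof. by rewrite dotHDr dotHNr. Qed.

Lemma dotHDl psi1 psi2 chi :
  dotH (psi1 + psi2) chi = dotH psi1 chi + dotH psi2 chi.
Proof. by rewrite dotHC dotHDr (dotHC chi psi1) (dotHC chi psi2) [LHS]rmorphD. Qed.

Lemma dotHZl a psi chi : dotH (a *: psi) chi = conjc a * dotH psi chi.
Proof. by rewrite dotHC dotHZr (dotHC chi psi) [LHS]rmorphM. Qed.

Lemma dotHNl psi chi : dotH (- psi) chi = - dotH psi chi.
Proof. by rewrite dotHC dotHNr (dotHC chi psi) [LHS]rmorphN. Qed.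

Lemma dotH_sumr I (r : seq I) (P : pred I) (F : I -> H) psi :
  dotH psi (\sum_(i <- r | P i) F i) = \sum_(i <- r | P i) dotH psi (F i).
Proof.
elim/big_rec2: _ => [|i y1 y2 _ <-]; first exact: dotH0r.
by rewrite dotHDr.
Qed.

Lemma dotH_suml I (r : seq I) (P : pred I) (F : I -> H) psi :
  dotH (\sum_(i <- r | P i) F i) psi = \sum_(i <- r | P i) dotH (F i) psi.
Proof.
elim/big_rec2: _ => [|i y1 y2 _ <-]; first by rewrite dotHC dotH0r conjc0.
by rewrite dotHDl.
Qed.

Lemma rdotDr psi chi1 chi2 : rdot psi (chi1 + chi2) = rdot psi chi1 + rdot psi chi2.
Proof. by rewrite /rdot dotHDr raddfD. Qed.

Lemma rdotNr psi chi : rdot psi (- chi) = - rdot psi chi.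
Proof. by rewrite /rdot dotHNr raddfN. Qed.

Lemma rdotBr psi chi1 chi2 : rdot psi (chi1 - chi2) = rdot psi chi1 - rdot psi chi2.
Proof. by rewrite rdotDr rdotNr. Qed.

Lemma rdotDl psi1 psi2 chi : rdot (psi1 + psi2) chi = rdot psi1 chi + rdot psi2 chi.
Proof. by rewrite rdotC rdotDr !(rdotC chi). Qed.

Lemma rdotNl psi chi : rdot (- psi) chi = - rdot psi chi.
Proof. by rewrite rdotC rdotNr rdotC. Qed.

Lemma rdotBl psi1 psi2 chi : rdot (psi1 - psi2) chi = rdot psi1 chi - rdot psi2 chi.
Proof. by rewrite rdotDl rdotNl. Qed.

Lemma rdotZr psi (r : R) chi : rdot psi (r%:C *: chi) = r * rdot psi chi.
Proof. by rewrite /rdot dotHZr; case: (dotH psi chi) => a b /=; rewrite mul0r subr0. Qed.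

Lemma rdotZl psi (r : R) chi : rdot (r%:C *: psi) chi = r * rdot psi chi.
Proof. by rewrite rdotC rdotZr rdotC. Qed.

Lemma rdot0l psi : rdot 0 psi = 0.
Proof. by rewrite -(subrr (0 : H)) rdotBl subrr. Qed.

Lemma normH_ge0 psi : 0 <= normH psi.
Proof. exact: sqrtr_ge0. Qed.

Lemma normH_sqr psi : normH psi ^+ 2 = rdot psi psi.
Proof. by rewrite /normH sqr_sqrtr// dotH_ge0. Qed.

Lemma normH_eq0 psi : normH psi = 0 -> psi = 0.
Proof. by move=> h; apply: dotH_eq0; rewrite -[LHS]normH_sqr h expr0n. Qed.

Lemma normH0 : normH (0 : H) = 0.
Proof. by apply/eqP; rewrite -sqrf_eq0 normH_sqr rdot0l. Qed.

Lemma normHN psi : normH (- psi) = normH psi.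
Proof. by rewrite /normH dotHNr dotHNl opprK. Qed.

Lemma normHZ (r : R) psi : normH (r%:C *: psi) = `|r| * normH psi.
Proof.
apply/eqP; rewrite -(@eqrXn2 _ 2)// ?mulr_ge0 ?normH_ge0//.
by rewrite exprMn !normH_sqr rdotZl rdotZr real_normK ?num_real// mulrA -expr2.
Qed.

(** Cauchy-Schwarz, from the nonnegative square of the norm of psi - t chi at
    the minimizing t = <psi,chi> / |chi|^2. *)
Lemma rdot_le psi chi : rdot psi chi <= normH psi * normH chi.
Proof.
have [/normH_eq0 ->|c0] := eqVneq (normH chi) 0.
  by rewrite rdotC rdot0l mulr_ge0 ?normH_ge0.
have cp : 0 < normH chi by rewrite lt0r c0 normH_ge0.
set p := normH psi; set c := normH chi in c0 cp *; set s := rdot psi chi.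
have [s0|s0] := leP s 0; first by rewrite (le_trans s0)// mulr_ge0 ?normH_ge0.
have h : 0 <= p ^+ 2 - s ^+ 2 / c ^+ 2.
  suff -> : p ^+ 2 - s ^+ 2 / c ^+ 2 = normH (psi - (s / c ^+ 2)%:C *: chi) ^+ 2.
    exact: sqr_ge0.
  rewrite normH_sqr rdotBl !rdotBr !rdotZl !rdotZr (rdotC chi psi) -!normH_sqr.
  by rewrite -/p -/c -/s; field.
rewrite -(@ler_pXn2r _ 2)// ?nnegrE ?mulr_ge0 ?normH_ge0 ?(ltW s0) ?(ltW cp)//.
by move: h; rewrite exprMn subr_ge0 ler_pdivrMr ?exprn_gt0.
Qed.

Lemma normr_rdot_le psi chi : `|rdot psi chi| <= normH psi * normH chi.
Proof.
by rewrite ler_norml rdot_le andbT lerNl -rdotNr -(normHN chi) rdot_le.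
Qed.

Lemma normHD psi chi : normH (psi + chi) <= normH psi + normH chi.
Proof.
rewrite -(@ler_pXn2r _ 2)// ?nnegrE ?addr_ge0 ?normH_ge0//.
rewrite normH_sqr rdotDl !rdotDr (rdotC chi psi) -!normH_sqr sqrrD.
have := rdot_le psi chi; lra.
Qed.

Lemma rdot_eq0 psi : (forall chi, rdot chi psi = 0) -> psi = 0.
Proof. by move=> h; exact: dotH_eq0 (h psi). Qed.

End BoxSpace.

(** * Real calculus and cutoff functions *)

Section RealCalculus.
Context (R : realType).
Implicit Types (f g : R -> R) (x a b c e : R).

Lemma is_derive_mulf f g x df dg : is_derive x 1 f df -> is_derive x 1 g dg ->
  is_derive x 1 (fun y => f y * g y) (df * g x + f x * dg).
Proof.
move=> hf hg; apply: (@is_derive_eq _ _ _ (f * g)).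
by rewrite /GRing.scale/=; ring.
Qed.

Lemma is_derive_addf f g x df dg : is_derive x 1 f df -> is_derive x 1 g dg ->
  is_derive x 1 (fun y => f y + g y) (df + dg).
Proof. by move=> hf hg; exact: (@is_deriveD _ _ _ f g). Qed.

Lemma is_derive_scalef c f x df : is_derive x 1 f df ->
  is_derive x 1 (fun y => c * f y) (c * df).
Proof.
move=> hf; have := @is_derive_mulf (cst c) f x 0 df (is_derive_cst _ _ _) hf.
by rewrite mul0r add0r.
Qed.

Lemma is_derive_sin_scale c x : is_derive x 1 (fun y => sin (c * y)) (c * cos (c * x)).
Proof.
have h := is_derive_scalef c (@is_derive_id R _ x (1 : R)).
have := @is_derive1_comp R sin (fun y => c * y) x _ _ (is_derive_sin (c * x)) h.
by rewrite mulr1 mulrC.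
Qed.

Lemma is_derive_cos_scale c x : is_derive x 1 (fun y => cos (c * y)) (- c * sin (c * x)).
Proof.
have h := is_derive_scalef c (@is_derive_id R _ x (1 : R)).
have := @is_derive1_comp R cos (fun y => c * y) x _ _ (is_derive_cos (c * x)) h.
by rewrite mulr1 mulrC mulrN mulNr.
Qed.

Lemma is_derive_continuous f df : (forall x, is_derive x 1 f (df x)) -> continuous f.
Proof. by move=> h x; apply: differentiable_continuous; apply/derivable1_diffP. Qed.

Lemma continuous_mulf f g : continuous f -> continuous g ->
  continuous (fun y => f y * g y).
Proof. by move=> hf hg x; apply: cvgM; [exact: hf|exact: hg]. Qed.

Lemma continuous_addf f g : continuous f -> continuous g ->
  continuous (fun y => f y + g y).
Proof. by move=> hf hg x; apply: cvgD; [exact: hf|exact: hg]. Qed.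

Lemma continuous_scalef c f : continuous f -> continuous (fun y => c * f y).
Proof. by move=> hf x; apply: cvgM; [exact: cvg_cst|exact: hf]. Qed.

(** Its square is the simplest C^1 function that vanishes on a half-line. *)
Definition pospart x : R := Num.max 0 x.

Lemma continuous_pospart : continuous pospart.
Proof. by move=> x; apply: continuous_max; [exact: cvg_cst|exact: cvg_id]. Qed.

(** At 0 the difference quotient is bounded by |h|; elsewhere the function
    agrees locally with 0 or with a square. *)
Lemma is_derive_pospart_sqr x :
  is_derive x 1 (fun y => pospart y ^+ 2) (2 * pospart x).
Proof.
have [x0|x0|->] := ltgtP x 0.
- apply: (@near_eq_is_derive _ _ _ (cst 0)).
    near=> y; rewrite /cst/= /pospart max_l ?expr0n//.
    by apply: ltW; near: y; exact: lt_nbhsl.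
  rewrite /pospart max_l ?mulr0 ?ltW//; exact: is_derive_cst.
- have h := @is_derive_id R _ x (1 : R).
  have hs : is_derive x 1 (fun y : R => y * y) (2 * pospart x).
    apply: (is_derive_eq (is_derive_mulf h h)).
    by rewrite /pospart max_r ?ltW// mulr1 mul1r mulr_natl mulr2n.
  apply: near_eq_is_derive hs.
  near=> y; rewrite /pospart max_r ?expr2//.
  by apply: ltW; near: y; exact: lt_nbhsr.
rewrite /pospart maxxx mulr0.
have lim0 : h^-1 *: (Num.max 0 (h *: (1 : R) + 0) ^+ 2 - Num.max 0 0 ^+ 2) @[h --> 0^'] --> (0 : R).
  apply: (@squeeze_cvgr _ _ _ _ (fun h => - `|h|) (fun h => `|h|)).
  - near=> h; rewrite maxxx expr0n/= subr0 addr0 /GRing.scale/= mulr1 -ler_norml.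
    have h0 : h != 0 by near: h; exact: nbhs_dnbhs_neq.
    rewrite normrM normfV normrX ler_pdivrMl ?normr_gt0// -expr2 ler_sqr ?nnegrE//.
    by rewrite /Num.max; case: ifP => _; rewrite ?normr0.
  - rewrite -[X in _ --> X]oppr0 -[X in _ --> - X](normr0 R); apply: cvgN.
    apply: cvg_norm; apply: cvg_within_filter; exact: cvg_id.
  - rewrite -[X in _ --> X](normr0 R).
    apply: cvg_norm; apply: cvg_within_filter; exact: cvg_id.
apply: DeriveDef; first by apply/cvg_ex; exists 0.
by apply: cvg_lim.
Unshelve. all: by end_near. Qed.

(** Positive exactly on the open interval from a to b, when a < b. *)
Definition hump a b x : R := pospart ((x - a) * (b - x)).

(** For a < b and e > 0, a C^1 function with values in [0, 1] and support in [a,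
    b], which tends to 1 inside the interval as e tends to 0. One family serves
    both as test functions separating points of L^2 and as truncations of
    functions vanishing at the boundary. *)
Definition cutoff a b e x : R := hump a b x ^+ 2 / (hump a b x ^+ 2 + e ^+ 2).
Definition dcutoff a b e x : R :=
  2 * hump a b x * (a + b - 2 * x) * e ^+ 2 / (hump a b x ^+ 2 + e ^+ 2) ^+ 2.

Lemma hump_ge0 a b x : 0 <= hump a b x.
Proof. by rewrite /hump /pospart le_max lexx. Qed.

Lemma hump_eq0 a b x : a <= b -> ~~ (a <= x <= b) -> hump a b x = 0.
Proof.
move=> ab h; rewrite /hump /pospart max_l//.
move: h; rewrite negb_and -!ltNge => /orP[h|h]; nra.
Qed.

Lemma hump_in a b x : a <= x <= b -> hump a b x = (x - a) * (b - x).
Proof. by move=> /andP[h1 h2]; rewrite /hump /pospart max_r// mulr_ge0 ?subr_ge0. Qed.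

Lemma is_derive_hump_arg a b x :
  is_derive x 1 (fun y => (y - a) * (b - y)) (a + b - 2 * x).
Proof.
have h1 : is_derive x 1 (fun y => y - a) 1.
  apply: (is_derive_eq (is_derive_addf (is_derive_id _ _) (is_derive_cst _ _ _))).
  by rewrite addr0.
have h2 : is_derive x 1 (fun y => b - y) (-1).
  apply: (is_derive_eq (is_derive_addf (is_derive_cst _ _ _) (is_deriveNid _ _))).
  by rewrite add0r.
apply: (is_derive_eq (is_derive_mulf h1 h2)).
by ring.
Qed.

Lemma continuous_hump a b : continuous (hump a b).
Proof.
move=> x; apply: (@continuous_comp _ _ _ (fun y => (y - a) * (b - y)) pospart).
  exact: (is_derive_continuous (is_derive_hump_arg a b)).
exact: continuous_pospart.
Qed.

Lemma is_derive_cutoff a b e x : 0 < e ->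
  is_derive x 1 (cutoff a b e) (dcutoff a b e x).
Proof.
move=> e0; pose p y := hump a b y ^+ 2; set q := a + b - 2 * x.
have hp : is_derive x 1 p (2 * hump a b x * q).
  exact: (is_derive1_comp (is_derive_pospart_sqr _) (is_derive_hump_arg a b x)).
have hc : is_derive x 1 (fun y => p y + e ^+ 2) (2 * hump a b x * q).
  apply: (is_derive_eq (is_derive_addf hp (is_derive_cst _ _ _))).
  by rewrite addr0.
have nz : p x + e ^+ 2 != 0.
  by rewrite gt_eqF// ltr_wpDl ?sqr_ge0// exprn_gt0.
rewrite -[cutoff a b e]/(fun y => p y * (p y + e ^+ 2)^-1).
have hv := @is_deriveV R (fun y => p y + e ^+ 2) x _ 1 nz hc.
apply: (is_derive_eq (is_derive_mulf hp hv)).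
by rewrite /dcutoff /GRing.scale/= -/(p x) -/q; field.
Qed.

Lemma continuous_dcutoff a b e : 0 < e -> continuous (dcutoff a b e).
Proof.
move=> e0; have cb := @continuous_hump a b; rewrite /dcutoff.
have c2 : continuous (fun y => hump a b y ^+ 2 + e ^+ 2).
  apply: continuous_addf; last by move=> x; exact: cvg_cst.
  exact: (continuous_mulf cb cb).
apply: continuous_mulf; last first.
  move=> x; apply: cvgV.
    by rewrite expf_neq0// gt_eqF// ltr_wpDl ?sqr_ge0// exprn_gt0.
  exact: (continuous_mulf c2 c2).
apply: continuous_mulf; last by move=> x; exact: cvg_cst.
apply: continuous_mulf; first exact: continuous_scalef.
move=> x; apply: cvgB; first exact: cvg_cst.
by apply: cvgM; [exact: cvg_cst|exact: cvg_id].
Qed.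

Lemma cutoff_itv a b e x : 0 < e -> 0 <= cutoff a b e x <= 1.
Proof.
move=> e0; rewrite divr_ge0 ?addr_ge0 ?sqr_ge0//= ler_pdivrMr ?mul1r ?lerDl ?sqr_ge0//.
by rewrite ltr_wpDl ?sqr_ge0// exprn_gt0.
Qed.

Lemma cutoff_eq0 a b e x : a <= b -> ~~ (a <= x <= b) -> cutoff a b e x = 0.
Proof. by move=> ab h; rewrite /cutoff hump_eq0// expr0n mul0r. Qed.

End RealCalculus.

(** * Integration over the box *)

Section BoxCalculus.
Context (R : realType).
Local Notation T := (measurableTypeR R).
Local Notation mu := (box_measure R).
Local Notation leb := (@lebesgue_measure R).
Implicit Types (f g : R -> R) (x a b e : R).

Lemma Lfun2_continuous f : continuous f -> (f : T -> R) \in Lfun mu 2%:E.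
Proof.
move=> cf.
have cn : {within `[0 : R, pi], continuous (fun x => `|f x|)}.
  apply: continuous_subspaceT => x.
  by apply: cvg_norm; exact: cf.
have [c _ hc] := EVT_max (ltW (@pi_gt0 R)) cn.
apply: (@Lfun2_bounded R f (`|f c|)); first exact: continuous_measurable_fun.
by move=> x /andP[x0 xp]; apply: hc; rewrite in_itv/= !ltW.
Qed.

Lemma Lfun2_integrable (f : T -> R) : f \in Lfun mu 2%:E ->
  mu.-integrable setT (EFin \o f).
Proof.
move=> f2; apply/Lfun1_integrable; apply: Lfun_subset12 => //.
rewrite ge0_fin_numE ?measure_ge0//; exact: box_measure_fin.
Qed.

(** The endpoints are null, so the integral over the open interval is the one
    over the closed interval. *)
Lemma box_FTC2 (F G : R -> R) : (forall x, is_derive x 1 F (G x)) ->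
  continuous G -> \int[mu]_x G x = F pi - F 0.
Proof.
move=> FG cG.
have cF := is_derive_continuous FG.
have I : leb.-integrable `[0, pi] (EFin \o G).
  apply: continuous_compact_integrable; first exact: segment_compact.
  exact: continuous_subspaceT.
rewrite integral_box; last exact: Lfun2_integrable (Lfun2_continuous cG).
have h1 : leb.-integrable `[0, pi[ (EFin \o G).
  apply: integrableS I => //; apply: subset_itvl; by rewrite bnd_simp.
have h2 : leb.-integrable `]0, pi[ (EFin \o G).
  apply: integrableS h1 => //; apply: subset_itvr; by rewrite bnd_simp.
rewrite Rintegral_itv_obnd_cbnd// Rintegral_itv_bndo_bndc// /Rintegral.
rewrite (@continuous_FTC2 R G F 0 pi)// ?pi_gt0//.
- exact: continuous_subspaceT.
- split; first by move=> x _; apply: ex_derive; exact: FG.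
  + exact/cvg_at_right_filter/cF.
  + exact/cvg_at_left_filter/cF.
- by move=> x _; rewrite derive1E; apply: derive_val.
Qed.

Lemma box_dominated (f_ : nat -> T -> R) (f g : T -> R) :
  (forall n, measurable_fun [set: T] (f_ n)) -> measurable_fun [set: T] f ->
  mu.-integrable setT (EFin \o g) ->
  (forall x, 0 < x < pi -> f_ ^~ x @ \oo --> f x) ->
  (forall x n, 0 < x < pi -> `|f_ n x| <= g x) ->
  (fun n => \int[mu]_x f_ n x) @ \oo --> \int[mu]_x f x.
Proof.
move=> mf_ mf ig ff fg.
have aeP (P : T -> Prop) : (forall x, 0 < x < pi -> P x) -> {ae mu, forall x, P x}.
  move=> h; exists (~` [set` `]0%R, pi[]); split.
  - exact: measurableC.
  - by rewrite box_measureE setICl measure0.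
  - by move=> x /= nP xI; apply: nP; apply: h; move: xI; rewrite /= in_itv.
have [||||| If _ C] := @dominated_convergence _ T R mu setT measurableT
  (fun n => EFin \o f_ n) (EFin \o f) (EFin \o g).
- by move=> n; exact/measurable_EFinP.
- exact/measurable_EFinP.
- by apply: aeP => x hx _; apply: cvg_EFin; [exact: nearW|exact: ff].
- by [].
- by apply: aeP => x hx n _; rewrite lee_fin; exact: fg.
apply: fine_cvg; rewrite fineK; last exact: integrable_fin_num If.
exact: C.
Qed.

Lemma ratio_cvg1 (m_ e_ : nat -> R) (m : R) : m != 0 -> m_ @ \oo --> m ->
  e_ @ \oo --> (0 : R) ->
  (fun n => m_ n ^+ 2 / (m_ n ^+ 2 + e_ n ^+ 2)) @ \oo --> (1 : R).
Proof.
move=> m0 hm he.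
have hm2 : (fun n => m_ n ^+ 2) @ \oo --> m ^+ 2 by rewrite expr2; exact: cvgM.
have he2 : (fun n => e_ n ^+ 2) @ \oo --> (0 : R).
  by rewrite -(mulr0 (0 : R)); exact: cvgM.
rewrite -(@divff _ (m ^+ 2)) ?expf_neq0//; apply: cvgM => //.
apply: cvgV; first by rewrite expf_neq0.
by rewrite -[X in _ --> X]addr0; exact: cvgD.
Qed.

(** The cutoffs of an interval converge to its indicator function, so by
    dominated convergence h has zero integral over every interval inside the
    box. Its primitive is then locally constant, and it is almost everywhere
    differentiable with derivative h by Lebesgue's theorem. *)
Lemma du_bois_reymond (h : T -> R) : h \in Lfun mu 2%:E ->
  (forall a b e, 0 < a -> a < b -> b < pi -> 0 < e ->
     \int[mu]_x (cutoff a b e x * h x) = 0) ->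
  {ae mu, forall x, h x = 0}.
Proof.
move=> h2 h0; have ih := Lfun2_integrable h2.
have mh : measurable_fun [set: T] h by apply/measurable_EFinP; exact: measurable_int ih.
have ihD := integrable_box ih.
have e0 n : 0 < n.+1%:R^-1 :> R by rewrite invr_gt0.
have I a b : 0 < a -> a < b -> b < pi -> \int[leb]_(x in `]a, b[) h x = 0.
  move=> a0 ab bpi.
  have c n : \int[mu]_x (cutoff a b n.+1%:R^-1 x * h x) = 0 by exact: h0.
  pose hab (x : T) : R := (\1_`]a, b[ x * h x)%R.
  have mab : measurable_fun [set: T] hab.
    apply: measurable_funM => //; exact: measurable_indic.
  have C : (fun n => \int[mu]_x (cutoff a b n.+1%:R^-1 x * h x)) @ \oo -->
      \int[mu]_x hab x.
    apply: (@box_dominated _ _ (fun x => `|h x|)) => //.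
    - move=> n; apply: measurable_funM => //.
      apply: continuous_measurable_fun.
      exact: (is_derive_continuous (fun x => is_derive_cutoff a b x (e0 n))).
    - exact: integrable_norm ih.
    - move=> x _; apply: cvgM; last exact: cvg_cst.
      rewrite indicE; have [xab|xab] := boolP (x \in _).
        have b0 : hump a b x != 0.
          move: xab; rewrite inE/= in_itv/= => /andP[ax xb].
          by rewrite hump_in ?ltW// mulf_neq0// gt_eqF// subr_gt0.
        exact: (@ratio_cvg1 (cst (hump a b x)) (fun n => n.+1%:R^-1) _ b0
          (cvg_cst _) (@cvg_harmonic R)).
      rewrite (_ : (fun _ => _) = cst 0); first exact: cvg_cst.
      apply/funext => n; rewrite /cutoff (_ : hump a b x = 0) ?expr0n ?mul0r//.
      have [xab'|] := boolP (a <= x <= b); last by apply: hump_eq0; exact: ltW.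
      rewrite hump_in//; apply/eqP; rewrite mulf_eq0 !subr_eq0.
      move: xab xab'; rewrite mem_setE in_itv/= negb_and -!leNgt.
      by move=> /orP[h1|h1] /andP[h3 h4]; apply/orP; [left|right];
        rewrite eq_le h1// ?h3 ?h4.
    - move=> x n _; rewrite normrM ler_piMl//.
      by have /andP[c0 c1] := cutoff_itv a b x (e0 n); rewrite ger0_norm.
  have ihab : mu.-integrable setT (EFin \o hab).
    apply: (le_integrable measurableT _ _ ih); first exact/measurable_EFinP.
    move=> x _; rewrite /= /hab lee_fin normrM indicE ler_piMl//.
    by case: (x \in _); rewrite ?normr1 ?normr0.
  have -> : \int[leb]_(x in `]a, b[) h x = \int[mu]_x hab x.
    rewrite integral_box// Rintegral_mkcond [RHS]Rintegral_mkcond.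
    apply: eq_Rintegral => x _; rewrite !patchE /hab indicE !mem_setE !in_itv/=.
    case: ifPn => [/andP[ax xb]|_]; last by rewrite mul0r; case: ifP.
    by rewrite (lt_trans a0 ax) (lt_trans xb bpi) mul1r.
  have {C}C : cst (0 : R) @ \oo --> \int[mu]_x hab x.
    by move: C; rewrite (_ : (fun _ => _) = cst 0)//; apply/funext => n; rewrite c.
  apply: (@cvg_unique _ (@Rhausdorff R) _ _ _ _ C (cvg_cst _)).
(* Extension by zero, so that the primitive is defined on the whole line. *)
pose hD := (h : R -> R) \_ `]0, pi[.
have lD : locally_integrable setT hD by exact: integrable_locally ihD.
have iD : leb.-integrable setT (EFin \o hD).
  by move: ihD => /(integrable_mkcond _ _).1; rewrite restrict_EFin; apply.
have iDy y : leb.-integrable `]-oo, y] (EFin \o hD) by exact: integrableS iD.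
have := FTC1Ny iDy lD; set F := fun y => _; move=> [N [mN N0 hN]].
exists (N `|` ~` [set` `]0%R, pi[]); split.
- by apply: measurableU => //; exact: measurableC.
- rewrite box_measureE setIUl setICl setU0.
  apply/eqP; rewrite -measure_le0 -N0; apply: le_measure; rewrite ?inE//.
  exact: measurableI.
move=> x hx; apply: contrapT => /not_orP[xN /contrapT xD].
apply: hx; have [dF F'] : derivable F x 1 /\ derive1 F x = hD x.
  by apply: contrapT => /hN.
have hDx : hD x = h x by rewrite /hD patchE mem_set.
change (h x = 0); rewrite -hDx -F'; move: xD; rewrite /= in_itv/= => /andP[x0 xpi].
have Fc a b : 0 < a -> a < b -> b < pi -> F b = F a.
  move=> a0 ab bpi; apply/eqP; rewrite -subr_eq0; apply/eqP.
  rewrite /F Rintegral_itvB//= ?bnd_simp ?ltW//.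
  rewrite -Rintegral_itv_bndo_bndc; last exact: integrableS iD.
  rewrite -[RHS](I _ _ a0 ab bpi); apply: eq_Rintegral => y.
  rewrite mem_setE in_itv/= => /andP[ay yb].
  by rewrite /hD patchE mem_setE in_itv/= (lt_trans a0 ay) (lt_trans yb bpi).
rewrite derive1E (@near_eq_derive _ _ _ F (cst (F x))) ?derive_cst//.
near=> y; have y0 : 0 < y by near: y; exact: lt_nbhsr.
have ypi : y < pi by near: y; exact: lt_nbhsl.
by have [yx|yx|->//] := ltgtP y x; rewrite /cst/= (Fc _ _ _ yx).
Unshelve. all: by end_near. Qed.

End BoxCalculus.

(** * Weak derivatives *)

Section WeakDerivative.
Context (R : realType).
Local Notation T := (measurableTypeR R).
Local Notation mu := (box_measure R).
Local Notation H := (Hbox R).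
Implicit Types (p q : R -> R) (psi chi : H) (x a b e : R).

Lemma toHZ (c : R[i]) (f : R -> R[i]) : f \in @L2fun R ->
  toH (fun x => c * f x) = c *: toH f.
Proof.
move=> f2; rewrite -[RHS]toH_funH; apply: toH_ae.
- exact: (rpredZ c f2).
- exact: funH_L2.
- by apply: filterS2 (funHZ c (toH f)) (funH_toH f2) => x -> ->.
Qed.

Lemma toHB (f g : R -> R[i]) : f \in @L2fun R -> g \in @L2fun R ->
  toH (fun x => f x - g x) = toH f - toH g.
Proof.
move=> f2 g2; rewrite -[RHS]toH_funH; apply: toH_ae.
- exact: (rpredB f2 g2).
- exact: funH_L2.
- have hN := funHZ (-1) (toH g); rewrite scaleN1r in hN.
  apply: filterS2 (filterI (funHD (toH f) (- toH g)) hN)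
    (filterI (funH_toH f2) (funH_toH g2)) => x [-> ->] [-> ->].
  by rewrite mulN1r.
Qed.

(** The eigenfunctions and the cutoffs are real-valued; the real and imaginary
    parts of other functions are paired with them separately. *)
Definition realC p : R -> R[i] := fun x => (p x)%:C.

Lemma L2fun_realC p : (p : T -> R) \in Lfun mu 2%:E -> realC p \in @L2fun R.
Proof.
move=> p2; apply/andP; split; first exact: p2.
exact: (Lfun2_continuous (fun x => cvg_cst _)).
Qed.

Lemma dotH_realC p psi : (p : T -> R) \in Lfun mu 2%:E ->
  dotH (toH (realC p)) psi =
  (\int[mu]_x (p x * Re (funH psi x))) +i* (\int[mu]_x (p x * Im (funH psi x))).
Proof.
move=> p2; rewrite (@dotH_ae _ (realC p) (funH psi)).
- rewrite /Cintegral; congr (_ +i* _); apply: eq_Rintegral => x _;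
  by case: (funH psi x) => [? ?]; rewrite /realC /=; ring.
- exact: L2fun_realC.
- exact: funH_L2.
- exact/funH_toH/L2fun_realC.
- exact: aeW.
Qed.

Lemma normH_realC p : (p : T -> R) \in Lfun mu 2%:E ->
  normH (toH (realC p)) ^+ 2 = \int[mu]_x (p x ^+ 2).
Proof.
move=> p2; rewrite normH_sqr /rdot dotH_toH; [|exact: L2fun_realC..].
by apply: eq_Rintegral => x _; rewrite /realC /=; ring.
Qed.

Lemma test_function_realC p q a b : (forall x, is_derive x 1 p (q x)) ->
  continuous q -> 0 < a -> b < pi -> (forall x, ~~ (a <= x <= b) -> p x = 0) ->
  test_function (realC p) /\ Cderiv (realC p) = realC q.
Proof.
move=> pq cq a0 bpi p0.
have E : Cderiv (realC p) = realC q.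
  apply/funext => x; rewrite /Cderiv /realC /=; congr (_ +i* _).
    by rewrite derive1E; apply: derive_val.
  by rewrite derive1_cst.
split=> //; split.
- by move=> x; split; [apply: ex_derive; exact: pq|exact: derivable_cst].
- by rewrite E.
- by rewrite E => x; exact: cvg_cst.
- by exists a, b; split => // x /p0; rewrite /realC => ->.
Qed.

(** The difference of two weak derivatives is orthogonal to all cutoffs, and its
    real and imaginary parts vanish by [du_bois_reymond]. *)
Lemma weak_derivative_unique psi chi1 chi2 : is_weak_derivative psi chi1 ->
  is_weak_derivative psi chi2 -> chi1 = chi2.
Proof.
move=> h1 h2; apply/eqP; rewrite -subr_eq0; apply/eqP; set chi := chi1 - chi2.
have h f : test_function f -> dotH (toH f) chi = 0.
  by move=> tf; rewrite dotHBr; apply/eqP; rewrite subr_eq0 -eqr_opp -h1// h2.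
have c2 a b e : 0 < e -> (cutoff a b e : T -> R) \in Lfun mu 2%:E.
  move=> e0; apply: Lfun2_continuous.
  exact: (is_derive_continuous (fun x => is_derive_cutoff a b x e0)).
have hc a b e : 0 < a -> a < b -> b < pi -> 0 < e ->
    dotH (toH (realC (cutoff a b e))) chi = 0.
  move=> a0 ab bpi e0; apply: h.
  apply: (@test_function_realC _ (dcutoff a b e) a b _ _ a0 bpi _).1 => //.
  - by move=> x; exact: is_derive_cutoff.
  - exact: continuous_dcutoff.
  - by move=> x; apply: cutoff_eq0; exact: ltW.
have /andP[chir chii] := funH_L2 chi.
have r0 : {ae mu, forall x, Re (funH chi x) = 0}.
  apply: (du_bois_reymond chir) => a b e a0 ab bpi e0.
  have := hc _ _ _ a0 ab bpi e0; rewrite dotH_realC; last exact: c2.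
  by move=> /(congr1 (@Re R)).
have i0 : {ae mu, forall x, Im (funH chi x) = 0}.
  apply: (du_bois_reymond chii) => a b e a0 ab bpi e0.
  have := hc _ _ _ a0 ab bpi e0; rewrite dotH_realC; last exact: c2.
  by move=> /(congr1 (@Im R)).
apply: dotH_eq0; have z2 : (0 : R -> R[i]) \in @L2fun R by exact: rpred0.
have z : {ae mu, forall x, funH chi x = 0}.
  by apply: filterS2 r0 i0 => x; case: (funH chi x) => [? ?] /= -> ->.
rewrite (dotH_ae z2 z2 z z); transitivity (\int[mu]_x (0 : R)).
  by apply: eq_Rintegral => x _; rewrite mulr0.
by rewrite Rintegral_cst// mul0r.
Qed.

Lemma wderivE psi chi : is_weak_derivative psi chi -> wderiv psi = chi.
Proof.
move=> h; apply: (weak_derivative_unique _ h).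
exact: (@xgetPex _ 0 [set chi | is_weak_derivative psi chi] (ex_intro _ chi h)).
Qed.

Lemma weak_derivativeB psi1 psi2 chi1 chi2 : is_weak_derivative psi1 chi1 ->
  is_weak_derivative psi2 chi2 -> is_weak_derivative (psi1 - psi2) (chi1 - chi2).
Proof. by move=> h1 h2 f tf; rewrite !dotHBr h1// h2// opprB opprK addrC. Qed.

(** No boundary terms, because u is supported inside the box. *)
Lemma box_by_parts p q (u v : R -> R) a b : (forall x, is_derive x 1 p (q x)) ->
  continuous q -> (forall x, is_derive x 1 u (v x)) -> continuous v ->
  0 < a -> b < pi -> (forall x, ~~ (a <= x <= b) -> u x = 0) ->
  \int[mu]_x (v x * p x) = - \int[mu]_x (u x * q x).
Proof.
move=> pq cq uv cv a0 bpi u0.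
have L := Lfun2_continuous.
have cp := is_derive_continuous pq; have cu := is_derive_continuous uv.
apply/eqP; rewrite -subr_eq0 opprK -RintegralD//; last 2 first.
- exact: Lfun2_mul_integrable (L _ _ cv) (L _ _ cp).
- exact: Lfun2_mul_integrable (L _ _ cu) (L _ _ cq).
rewrite (box_FTC2 (fun x => is_derive_mulf (uv x) (pq x))).
  by rewrite !u0 ?mul0r ?subrr// negb_and -!ltNge ?a0 ?bpi ?orbT.
by apply: continuous_addf; exact: continuous_mulf.
Qed.

(** Integration by parts against the real and imaginary parts of a test
    function. *)
Lemma weak_derivative_C1 p q : (forall x, is_derive x 1 p (q x)) ->
  continuous q -> is_weak_derivative (toH (realC p)) (toH (realC q)).
Proof.
move=> pq cq f [df cr ci [a [b [a0 bpi f0]]]].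
have L := Lfun2_continuous.
have cp := is_derive_continuous pq.
have dr x : is_derive x 1 (fun y => Re (f y)) (Re (Cderiv f x)).
  by apply: DeriveDef; [case: (df x)|rewrite /Cderiv/= derive1E].
have di x : is_derive x 1 (fun y => Im (f y)) (Im (Cderiv f x)).
  by apply: DeriveDef; [case: (df x)|rewrite /Cderiv/= derive1E].
have f2 : f \in @L2fun R.
  by apply/andP; split; apply: L; [exact: (is_derive_continuous dr)|exact: (is_derive_continuous di)].
have df2 : Cderiv f \in @L2fun R by apply/andP; split; exact: L.
rewrite !dotH_toH//; [|exact/L2fun_realC/L..].
have hr := box_by_parts pq cq dr cr a0 bpi (fun x h => congr1 (@Re R) (f0 x h)).
have hi := box_by_parts pq cq di ci a0 bpi (fun x h => congr1 (@Im R) (f0 x h)).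
have E (g : R -> R[i]) (r : R -> R) : g \in @L2fun R ->
    (r : T -> R) \in Lfun mu 2%:E -> Cintegral (fun x => (g x)^* * realC r x) =
    (\int[mu]_x (Re (g x) * r x)) +i* (- 1 * \int[mu]_x (Im (g x) * r x)).
  move=> /andP[_ g2] r2; rewrite -RintegralZl//; last exact: Lfun2_mul_integrable.
  rewrite /Cintegral; congr (_ +i* _); apply: eq_Rintegral => x _;
  by case: (g x) => [? ?]; rewrite /realC /=; ring.
rewrite !E//; [|exact: L..]; rewrite hr hi.
by apply/eqP; rewrite eq_complex /= mulrN !eqxx.
Qed.

End WeakDerivative.

(** * C^1 functions vanishing at both ends *)

Section VanishingTrace.
Context (R : realType).
Local Notation T := (measurableTypeR R).
Local Notation mu := (box_measure R).
Local Notation H := (Hbox R).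
Implicit Types (p q g : R -> R) (psi chi : H) (x a b e d : R).

(** Dominated convergence of the squares. *)
Lemma normH_realC_cvg0 (r_ : nat -> R -> R) g :
  (forall n, continuous (r_ n)) -> continuous g ->
  (forall x, 0 < x < pi -> r_ ^~ x @ \oo --> (0 : R)) ->
  (forall x n, 0 < x < pi -> `|r_ n x| <= g x) ->
  (fun n => normH (toH (realC (r_ n))) ^+ 2) @ \oo --> (0 : R).
Proof.
move=> cr cg r0 rg.
rewrite (_ : (fun n => _) = (fun n => \int[mu]_x (r_ n x ^+ 2))); last first.
  by apply/funext => n; rewrite normH_realC//; exact: Lfun2_continuous.
rewrite [X in _ --> X](_ : _ = \int[mu]_x (0 : R)); last first.
  by rewrite Rintegral_cst// mul0r.
apply: (@box_dominated R (fun n x => r_ n x ^+ 2) (cst 0) (fun x => g x * g x)) => //.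
- move=> n; apply: measurable_funX; exact: continuous_measurable_fun.
- apply: Lfun2_mul_integrable; exact: Lfun2_continuous.
- move=> x hx; rewrite -[X in _ --> X](mulr0 (0 : R)).
  by apply: cvgM; exact: r0.
- move=> x n hx; rewrite normrX expr2; apply: ler_pM => //; exact: rg.
Qed.

Lemma cvg_hump (d_ : nat -> R) x : d_ @ \oo --> (0 : R) ->
  0 < x < pi -> (fun n => hump (d_ n) (pi - d_ n) x) @ \oo --> x * (pi - x).
Proof.
move=> d0 /andP[x0 xpi].
have -> : x * (pi - x) = pospart ((x - 0) * (pi - 0 - x)).
  by rewrite !subr0 /pospart max_r// mulr_ge0 ?subr_ge0 ?ltW.
apply: (@continuous_cvg _ _ _ _ _ (fun n => (x - d_ n) * (pi - d_ n - x))).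
  exact: continuous_pospart.
apply: cvgM; first by apply: cvgB; [exact: cvg_cst|exact: d0].
apply: cvgB; last exact: cvg_cst.
by apply: cvgB; [exact: cvg_cst|exact: d0].
Qed.

(** The cutoff varies fast near the boundary, where a C^1 function vanishing at
    the ends is small: P is bounded by a multiple of x (pi - x), which is at
    most m + pi d where m is the hump. The estimate then follows from m d <= m^2
    + d^2. *)
Lemma dcutoff_bound (M P x d : R) : 0 < d -> d <= pi - d -> 0 < x < pi -> 0 <= M ->
  `|P| * pi <= 2 * M * (x * (pi - x)) ->
  `|P * dcutoff d (pi - d) d x| <= 4 * M * (1 + pi).
Proof.
move=> d0 dle /andP[x0 xpi] M0 hP; have pi0 := @pi_gt0 R.
rewrite /dcutoff; set m := hump _ _ _.
have m_ge0 : 0 <= m := hump_ge0 _ _ _.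
have -> : d + (pi - d) - 2 * x = pi - 2 * x by ring.
have [->|m0] := eqVneq m 0.
  by rewrite !(mulr0, mul0r) normr0; apply: mulr_ge0; [exact: mulr_ge0|rewrite addr_ge0// ltW].
have xd : d <= x <= pi - d.
  by apply: contraT => nxd; move: m0; rewrite /m hump_eq0 ?eqxx.
have mE : m = (x - d) * (pi - d - x) by rewrite /m hump_in.
set D := m ^+ 2 + d ^+ 2.
have D0 : 0 < D by rewrite ltr_wpDl ?sqr_ge0// exprn_gt0.
have h1 : `|pi - 2 * x| <= pi by rewrite ler_norml; apply/andP; split; lra.
have h2 : `|P| * pi <= 2 * M * (m + d * pi).
  apply: (le_trans hP); apply: ler_wpM2l; first by rewrite mulr_ge0.
  by rewrite mE; nra.
have h3 : (m + d * pi) * m * d ^+ 2 <= (1 + pi) * D ^+ 2.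
  have md : m * d <= D by have := sqr_ge0 (m - d); rewrite /D; nra.
  have mD : m ^+ 2 <= D by rewrite lerDl sqr_ge0.
  have dD : d ^+ 2 <= D by rewrite lerDr sqr_ge0.
  have k1 : m ^+ 2 * d ^+ 2 <= D * D by rewrite ler_pM ?sqr_ge0.
  have k2 : m * d * d ^+ 2 <= D * D by rewrite ler_pM ?sqr_ge0 ?mulr_ge0 ?(ltW d0).
  rewrite (_ : _ * m * _ = m ^+ 2 * d ^+ 2 + pi * (m * d * d ^+ 2)); last by ring.
  by rewrite [leRHS]mulrDl mul1r expr2 lerD// ler_wpM2l// ltW.
rewrite !normrM normfV !normrX !(ger0_norm (ltW D0)) !(ger0_norm m_ge0).
rewrite normr_nat (ger0_norm (ltW d0)) mulrA ler_pdivrMr ?exprn_gt0//.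
apply: (@le_trans _ _ (`|P| * (2 * m * pi * d ^+ 2))).
  by rewrite ler_wpM2l// ler_wpM2r ?sqr_ge0// ler_wpM2l// mulr_ge0.
rewrite (_ : `|P| * _ = 2 * m * d ^+ 2 * (`|P| * pi)); last by ring.
apply: (@le_trans _ _ (2 * m * d ^+ 2 * (2 * M * (m + d * pi)))).
  by rewrite ler_wpM2l// !mulr_ge0// ltW.
rewrite (_ : 2 * m * d ^+ 2 * _ = 4 * M * ((m + d * pi) * m * d ^+ 2)); last by ring.
by rewrite -[leRHS]mulrA ler_wpM2l// mulr_ge0.
Qed.

(** Multiply p by cutoffs whose support exhausts the box. The product converges
    to p, and its derivative q c + p c' converges to q: pointwise because c'
    tends to 0, and in L^2 because p c' stays bounded by [dcutoff_bound]. *)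
Lemma H10_C1 p q : (forall x, is_derive x 1 p (q x)) -> continuous q ->
  p 0 = 0 -> p pi = 0 -> sobolevH10 (toH (realC p)).
Proof.
move=> pq cq p0 ppi; have pi0 := @pi_gt0 R.
have cp := is_derive_continuous pq; have W := weak_derivative_C1 pq cq.
split; first by exists (toH (realC q)).
have [M M0 qM] : exists2 M, 0 <= M & forall x, 0 <= x <= pi -> `|q x| <= M.
  have cn : {within `[0 : R, pi], continuous (fun x => `|q x|)}.
    by apply: continuous_subspaceT => x; apply: cvg_norm; exact: cq.
  have [c _ hc] := EVT_max (ltW pi0) cn; exists `|q c| => //.
(* The mean value theorem bounds p by M x and by M (pi - x), and
   pi = x + (pi - x). *)
have pM x : 0 < x < pi -> `|p x| * pi <= 2 * M * (x * (pi - x)).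
  move=> /andP[x0 xpi].
  have [y /= + e1] := MVT_segment (ltW x0) (fun x _ => pq x) (continuous_subspaceT cp).
  rewrite in_itv/= => /andP[y0 yx].
  have [z /= + e2] := MVT_segment (ltW xpi) (fun x _ => pq x) (continuous_subspaceT cp).
  rewrite in_itv/= => /andP[xz zpi].
  have b1 : `|p x| <= M * x.
    rewrite p0 !subr0 in e1; rewrite e1 normrM (ger0_norm (ltW x0)).
    by apply: ler_wpM2r; [exact: ltW|apply: qM; rewrite y0 (le_trans yx)// ltW].
  have b2 : `|p x| <= M * (pi - x).
    have px0 : 0 <= pi - x by rewrite subr_ge0 ltW.
    rewrite ppi sub0r in e2; rewrite -normrN e2 normrM (ger0_norm px0).
    apply: ler_wpM2r => //.
    by apply: qM; rewrite zpi (le_trans _ xz)// ltW.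
  by nra.
(* d n <= pi / 4 keeps the interval from d n to pi - d n nonempty. *)
pose d (n : nat) : R := pi / 4 * n.+1%:R^-1.
have d0 n : 0 < d n by rewrite !mulr_gt0// invr_gt0.
have dcv : d @ \oo --> (0 : R).
  rewrite -(mulr0 (pi / 4)); apply: cvgM; [exact: cvg_cst|exact: cvg_harmonic].
have dle n : d n <= pi - d n.
  have : d n <= pi / 4.
    apply: ler_piMr; first by rewrite divr_ge0// ltW.
    by rewrite invf_le1// ler1n.
  lra.
pose c n := cutoff (d n) (pi - d n) (d n).
pose dc n := dcutoff (d n) (pi - d n) (d n).
pose F n x := p x * c n x; pose G n x := q x * c n x + p x * dc n x.
have cc n : continuous (c n).
  exact: (is_derive_continuous (fun x => is_derive_cutoff _ _ x (d0 n))).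
have FG n x : is_derive x 1 (F n) (G n x).
  exact: (is_derive_mulf (pq x) (is_derive_cutoff _ _ x (d0 n))).
have cG n : continuous (G n).
  apply: continuous_addf; apply: continuous_mulf => //.
  exact: continuous_dcutoff.
have cF n := is_derive_continuous (FG n).
have cvgc x : 0 < x < pi -> c ^~ x @ \oo --> (1 : R).
  move=> hx; apply: (@ratio_cvg1 R (fun n => hump (d n) (pi - d n) x) d (x * (pi - x))) => //.
    by case/andP: hx => x0 xpi; rewrite mulf_neq0 ?gt_eqF ?subr_gt0.
  exact: cvg_hump.
have cvgdc x : 0 < x < pi -> dc ^~ x @ \oo --> (0 : R).
  move=> hx; have m0 : x * (pi - x) != 0.
    by case/andP: hx => x0 xpi; rewrite mulf_neq0 ?gt_eqF ?subr_gt0.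
  have hm := cvg_hump dcv hx.
  rewrite [X in _ --> X](_ : 0 = 2 * (x * (pi - x)) * (0 + (pi - 0) - 2 * x) *
     (0 * 0) / (((x * (pi - x)) * (x * (pi - x)) + 0 * 0) *
       ((x * (pi - x)) * (x * (pi - x)) + 0 * 0))); last by rewrite !mulr0 mul0r.
  have hd : (fun n => hump (d n) (pi - d n) x ^+ 2 + d n ^+ 2) @ \oo -->
     (x * (pi - x)) * (x * (pi - x)) + 0 * 0.
    by apply: cvgD; apply: cvgM.
  apply: cvgM; last first.
    apply: cvgV; first by rewrite mulr0 addr0; exact: (mulf_neq0 (mulf_neq0 m0 m0) (mulf_neq0 m0 m0)).
    exact: cvgM.
  apply: cvgM; last exact: cvgM.
  apply: cvgM; first by apply: cvgM => //; exact: cvg_cst.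
  apply: cvgB; last exact: cvg_cst.
  by apply: cvgD => //; apply: cvgB => //; exact: cvg_cst.
have c01 n x : 0 <= c n x <= 1 by exact: cutoff_itv.
have L := @Lfun2_continuous R.
have N1 : (fun n => normH (toH (realC p) - toH (realC (F n))) ^+ 2) @ \oo --> (0 : R).
  rewrite (_ : (fun n => _) = (fun n => normH (toH (realC (fun x => p x - F n x))) ^+ 2)).
    apply: (@normH_realC_cvg0 _ (fun x => `|p x|)).
    - by move=> n x; apply: cvgB; [exact: cp|exact: cF].
    - by move=> x; apply: cvg_norm; exact: cp.
    - move=> x hx; rewrite -[X in _ --> X](subrr (p x)) -[X in _ - X]mulr1.
      by apply: cvgB; [exact: cvg_cst|apply: cvgM; [exact: cvg_cst|exact: cvgc]].
    - move=> x n hx; rewrite /F -[X in X - _]mulr1 -mulrBr normrM ler_piMr//.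
      have /andP[? ?] := c01 n x; rewrite ger0_norm ?subr_ge0//; lra.
  apply/funext => n; rewrite -toHB; [|exact/L2fun_realC/L..].
  by congr (normH (toH _) ^+ 2); apply/funext => x; rewrite /realC rmorphB.
have N2 : (fun n => normH (toH (realC q) - toH (realC (G n))) ^+ 2) @ \oo --> (0 : R).
  rewrite (_ : (fun n => _) = (fun n => normH (toH (realC (fun x => q x - G n x))) ^+ 2)).
    apply: (@normH_realC_cvg0 _ (fun x => `|q x| + 4 * M * (1 + pi))).
    - by move=> n x; apply: cvgB; [exact: cq|exact: cG].
    - move=> x; apply: cvgD; last exact: cvg_cst.
      by apply: cvg_norm; exact: cq.
    - move=> x hx; rewrite -[X in _ --> X](subrr (q x)) -[X in _ - X]mulr1.
      rewrite -[X in _ - X]addr0 -(mulr0 (p x)).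
      apply: cvgB; first exact: cvg_cst.
      apply: cvgD; apply: cvgM; do ?exact: cvg_cst; first exact: cvgc.
      exact: cvgdc.
    - move=> x n hx; rewrite /G opprD addrA.
      apply: (le_trans (ler_normB _ _)); apply: lerD; last first.
        by apply: dcutoff_bound => //; exact: pM.
      rewrite -[X in X - _]mulr1 -mulrBr normrM ler_piMr//.
      have /andP[? ?] := c01 n x; rewrite ger0_norm ?subr_ge0//; lra.
  apply/funext => n; rewrite -toHB; [|exact/L2fun_realC/L..].
  by congr (normH (toH _) ^+ 2); apply/funext => x; rewrite /realC rmorphB.
move=> e e0.
have : (fun n => normH (toH (realC p) - toH (realC (F n))) ^+ 2 +
   normH (toH (realC q) - toH (realC (G n))) ^+ 2) @ \oo --> (0 : R).
  by have := cvgD N1 N2; rewrite addr0; apply.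
move=> /cvgrPdist_lt /(_ (e ^+ 2)) /(_ (exprn_gt0 _ e0)) [n _ /(_ n (leqnn n))].
rewrite sub0r normrN ger0_norm ?addr_ge0 ?sqr_ge0// => he.
have F0 x : ~~ (d n <= x <= pi - d n) -> F n x = 0.
  by move=> hx; rewrite /F /c cutoff_eq0 ?mulr0.
have dpi : pi - d n < pi by rewrite gtrBl.
have [tF _] := test_function_realC (FG n) (cG n) (d0 n) dpi F0.
exists (realC (F n)) => //.
have WF := weak_derivative_C1 (FG n) (cG n).
rewrite /norm_sobolevH1 (wderivE (weak_derivativeB W WF)).
by rewrite -(ger0_norm (ltW e0)) -sqrtr_sqr ltr_sqrt// exprn_gt0.
Qed.

End VanishingTrace.

(** * Eigenfunctions of A and boundedness of B *)

Section BoxOperators.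
Context (R : realType).
Local Notation T := (measurableTypeR R).
Local Notation mu := (box_measure R).
Local Notation leb := (@lebesgue_measure R).
Local Notation H := (Hbox R).
Implicit Types (psi chi : H) (x : R) (k : nat).

Definition phi_coef : R := Num.sqrt (2 / pi).
Definition phif k x : R := phi_coef * sin (k%:R * x).
Definition dphif k x : R := phi_coef * (k%:R * cos (k%:R * x)).

Lemma is_derive_phif k x : is_derive x 1 (phif k) (dphif k x).
Proof. exact: (is_derive_scalef _ (is_derive_sin_scale _ _)). Qed.

Lemma is_derive_dphif k x : is_derive x 1 (dphif k) (- k%:R ^+ 2 * phif k x).
Proof.
apply: (is_derive_eq (is_derive_scalef _ (is_derive_scalef _ (is_derive_cos_scale k%:R x)))).
by rewrite /phif; ring.
Qed.

Lemma continuous_phif k : continuous (phif k).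
Proof. exact: is_derive_continuous (is_derive_phif k). Qed.

Lemma continuous_dphif k : continuous (dphif k).
Proof. exact: is_derive_continuous (is_derive_dphif k). Qed.

Lemma phiE k : phi R k = toH (realC (phif k)).
Proof. by []. Qed.

Lemma sin_natmul_pi k : sin (k%:R * pi) = 0 :> R.
Proof.
elim: k => [|k IH]; first by rewrite mul0r sin0.
by rewrite -natr1 mulrDl mul1r sinDpi IH oppr0.
Qed.

Lemma phif_L2 k : (phif k : T -> R) \in Lfun mu 2%:E.
Proof. exact/Lfun2_continuous/continuous_phif. Qed.

Lemma weak_derivative_phi k : is_weak_derivative (phi R k) (toH (realC (dphif k))).
Proof.
exact: (weak_derivative_C1 (is_derive_phif k) (@continuous_dphif k)).
Qed.

Lemma weak_derivative_dphi k :
  is_weak_derivative (toH (realC (dphif k))) ((- k%:R ^+ 2)%:C *: phi R k).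
Proof.
rewrite phiE -toHZ; last exact/L2fun_realC/phif_L2.
have := weak_derivative_C1 (is_derive_dphif k) (continuous_scalef (@continuous_phif k)).
rewrite (_ : realC (fun y => - k%:R ^+ 2 * phif k y) =
   (fun x => (- k%:R ^+ 2)%:C * realC (phif k) x))//.
by apply/funext => x; rewrite /realC rmorphM.
Qed.

(** The trace condition holds because sin vanishes at 0 and at k pi. *)
Lemma domA_phi k : domA (phi R k).
Proof.
have W1 := weak_derivative_phi k; have W2 := weak_derivative_dphi k.
split; first split.
- by exists (toH (realC (dphif k))).
- by rewrite (wderivE W1); exists ((- k%:R ^+ 2)%:C *: phi R k).
- apply: (H10_C1 (is_derive_phif k) (@continuous_dphif k)).
    by rewrite /phif mulr0 sin0 mulr0.
  by rewrite /phif sin_natmul_pi mulr0.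
Qed.

Lemma opA_phi k : opA (phi R k) = (0 -i* (k%:R ^+ 2 / 2)) *: phi R k.
Proof.
rewrite /opA (wderivE (weak_derivative_phi k)) (wderivE (weak_derivative_dphi k)).
rewrite scalerA; congr (_ *: _); simpc.
by congr (_ +i* _); ring.
Qed.

(** Through 2 sin(jx) sin(kx) = cos((j-k)x) - cos((j+k)x) and explicit
    primitives; the case j = k has the constant 1 in place of the first cosine.
    *)
Lemma phi_orthonormal j k : (0 < j)%N -> (0 < k)%N ->
  dotH (phi R j) (phi R k) = (j == k)%:R.
Proof.
move=> j0 k0; rewrite !phiE dotH_toH; [|exact/L2fun_realC/phif_L2..].
have -> : Cintegral (fun x => (realC (phif j) x)^* * realC (phif k) x) =
    (\int[mu]_x (phif j x * phif k x)) +i* 0.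
  rewrite /Cintegral; congr (_ +i* _).
    by apply: eq_Rintegral => x _; rewrite /realC /=; ring.
  transitivity (\int[mu]_x (0 : R)).
    by apply: eq_Rintegral => x _; rewrite /realC /=; ring.
  by rewrite Rintegral_cst// mul0r.
have c2 : phi_coef ^+ 2 = 2 / pi.
  by rewrite sqr_sqrtr// divr_ge0// ltW// pi_gt0.
have cjk : continuous (fun x => phif j x * phif k x).
  by apply: continuous_mulf; exact: continuous_phif.
have dS (c : R) x : c != 0 -> is_derive x 1 (fun y => (2 * c)^-1 * sin (c * y)) (cos (c * x) / 2).
  move=> c0; apply: (is_derive_eq (is_derive_scalef _ (is_derive_sin_scale c x))).
  by field.
have jk : (j%:R + k%:R : R) != 0 by rewrite -natrD pnatr_eq0 addn_eq0 negb_and -!lt0n j0.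
have E x : phif j x * phif k x = phi_coef ^+ 2 * (cos ((j%:R - k%:R) * x) / 2 +
    - 1 * (cos ((j%:R + k%:R) * x) / 2)).
  by rewrite mulrBl mulrDl cosB cosD /phif; field.
have sDpi : sin ((j%:R + k%:R) * pi) = 0 :> R by rewrite -natrD sin_natmul_pi.
have [e|ne] := eqVneq j k.
  have D x : is_derive x 1 (fun y => phi_coef ^+ 2 * (2^-1 * y +
      - 1 * ((2 * (j%:R + k%:R))^-1 * sin ((j%:R + k%:R) * y)))) (phif j x * phif k x).
    apply: (is_derive_eq (is_derive_scalef _ (is_derive_addf
      (is_derive_scalef _ (is_derive_id x 1)) (is_derive_scalef (-1) (dS _ x jk))))).
    by rewrite E e subrr mul0r cos0; ring.
  rewrite (box_FTC2 D cjk) sDpi !mulr0 sin0 !mulr0 c2 !(addr0, subr0, mulr0).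
  congr (_ +i* _).
  have pin0 : (pi : R) != 0 by rewrite gt_eqF// pi_gt0.
  by rewrite mulrACA mulfV ?pnatr_eq0// mul1r mulVf.
have jk' : (j%:R - k%:R : R) != 0 by rewrite subr_eq0 eqr_nat.
have D x : is_derive x 1 (fun y => phi_coef ^+ 2 *
    ((2 * (j%:R - k%:R))^-1 * sin ((j%:R - k%:R) * y) +
    - 1 * ((2 * (j%:R + k%:R))^-1 * sin ((j%:R + k%:R) * y)))) (phif j x * phif k x).
  apply: (is_derive_eq (is_derive_scalef _ (is_derive_addf
      (dS _ x jk') (is_derive_scalef (-1) (dS _ x jk))))).
  by rewrite E.
rewrite (box_FTC2 D cjk) sDpi mulrBl sinB !sin_natmul_pi !mulr0 sin0 mul0r.
by rewrite !(mulr0, addr0, subr0).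
Qed.

Definition mulix (f : R -> R[i]) : R -> R[i] := fun x => (0 +i* x) * f x.

Lemma mulix_L2 (f : R -> R[i]) : f \in @L2fun R -> mulix f \in @L2fun R.
Proof.
move=> /andP[fr fi]; have mF (g : T -> R) : g \in Lfun mu 2%:E -> measurable_fun [set: T] g.
  by move=> /Lfun2_integrable ig; apply/measurable_EFinP; exact: measurable_int ig.
have D (g : T -> R) : g \in Lfun mu 2%:E -> ((fun x => x * g x) : T -> R) \in Lfun mu 2%:E.
  move=> g2; apply: (@Lfun2_dominated _ _ g pi) => // [|x /andP[x0 xpi]].
    by apply: measurable_funM; [exact: measurable_id|exact: mF].
  by rewrite normrM ler_wpM2r// (ger0_norm (ltW x0)) ltW.
apply/andP; split.
  rewrite (_ : (fun x => _) = (fun x => x * (Im (f x) * - 1))).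
    by apply: D; apply: (Lfun_scale (-1) _ fi); rewrite ler1n.
  by apply/funext => x; rewrite /mulix; case: (f x) => [? ?] /=; ring.
rewrite (_ : (fun x => _) = (fun x => x * Re (f x))); first exact: D.
by apply/funext => x; rewrite /mulix; case: (f x) => [? ?] /=; ring.
Qed.

Lemma opB_ae psi : {ae mu, forall x, funH (opB psi) x = mulix (funH psi) x}.
Proof. exact/funH_toH/mulix_L2/funH_L2. Qed.

Lemma opB_skew psi chi : dotH (opB psi) chi = - dotH psi (opB chi).
Proof.
have P2 := mulix_L2 (funH_L2 psi); have C2 := mulix_L2 (funH_L2 chi).
rewrite (dotH_ae P2 (funH_L2 chi) (opB_ae psi) (aeW _ _))//.
rewrite (dotH_ae (funH_L2 psi) C2 (aeW _ _) (opB_ae chi))//.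
rewrite -mulN1r -CintegralZ; last exact: Cintegrable_mul (funH_L2 _) C2.
congr Cintegral; apply/funext => x; rewrite /mulix.
case: (funH psi x) (funH chi x) => [a b] [c d]; simpc.
by congr (_ +i* _); ring.
Qed.

(** Linearity follows from skew-symmetry alone, by testing against every vector.
    *)
Lemma opBP (a : R[i]) psi chi : opB (a *: psi + chi) = a *: opB psi + opB chi.
Proof.
apply/eqP; rewrite -subr_eq0; apply/eqP/rdot_eq0 => w; rewrite /rdot.
have S z : dotH w (opB z) = - dotH (opB w) z by rewrite opB_skew opprK.
by rewrite dotHBr dotHPr !S dotHPr mulrN -[X in _ - X]opprD subrr.
Qed.

Lemma normH_sqrE (f : R -> R[i]) psi : f \in @L2fun R ->
  {ae mu, forall x, funH psi x = f x} ->
  mu.-integrable setT (EFin \o (fun x => Re (f x) ^+ 2 + Im (f x) ^+ 2)) /\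
  normH psi ^+ 2 = \int[mu]_x (Re (f x) ^+ 2 + Im (f x) ^+ 2).
Proof.
move=> f2 pf; have /andP[fr fi] := f2; split.
  rewrite (_ : _ \o _ = (fun x => (Re (f x) ^+ 2)%R%:E) \+
     (fun x => (Im (f x) ^+ 2)%R%:E))%E//.
  by apply: integrableD => //; exact: Lfun2_integrable_sqr.
rewrite normH_sqr /rdot (dotH_ae f2 f2 pf pf); apply: eq_Rintegral => x _.
by case: (f x) => [? ?] /=; ring.
Qed.

Lemma opB_bound psi : normH (opB psi) <= pi * normH psi.
Proof.
have pi0 : 0 <= pi :> R by rewrite ltW// pi_gt0.
rewrite -(@ler_pXn2r _ 2)// ?nnegrE ?mulr_ge0 ?normH_ge0// exprMn.
have [I1 ->] := normH_sqrE (mulix_L2 (funH_L2 psi)) (opB_ae psi).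
have pp : {ae mu, forall x, funH psi x = funH psi x} by exact: aeW.
have [I2 ->] := normH_sqrE (funH_L2 psi) pp.
rewrite -RintegralZl// !integral_box//; last exact: integrableZl I2.
apply: le_Rintegral => //.
- exact: integrable_box I1.
- apply: (@integrable_box R (fun x => pi ^+ 2 * _)); exact: (integrableZl _ _ I2).
move=> x; rewrite /= in_itv/= => /andP[x0 xpi]; rewrite /mulix.
case: (funH psi x) => [a b] /=.
rewrite (_ : _ + _ = x ^+ 2 * (a ^+ 2 + b ^+ 2)); last by ring.
by rewrite ler_wpM2r ?addr_ge0 ?sqr_ge0// ler_sqr ?nnegrE// ltW.
Qed.

End BoxOperators.

(** * Spectral projections *)

Section Projections.
Context (R : realType).
Local Notation H := (Hbox R).
Local Notation phi := (phi R).
Implicit Types (psi chi : H) (k m n : nat) (c : nat -> R[i]).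

(** All vectors in the range of a projection have this form, on which A acts
    diagonally. *)
Definition phisum m c : H := \sum_(1 <= k < m.+1) c k *: phi k.

Lemma projHE m psi : projH m psi = phisum m (fun k => dotH (phi k) psi).
Proof. by []. Qed.

Lemma phisumP m (a : R[i]) c1 c2 :
  phisum m (fun k => a * c1 k + c2 k) = a *: phisum m c1 + phisum m c2.
Proof.
rewrite /phisum scaler_sumr -big_split/=; apply: eq_bigr => k _.
by rewrite scalerDl scalerA.
Qed.

Lemma eq_phisum m c1 c2 : (forall k, (0 < k <= m)%N -> c1 k = c2 k) ->
  phisum m c1 = phisum m c2.
Proof. by move=> h; apply: eq_big_nat => k hk; rewrite h. Qed.

Lemma dotH_phi_phisum m k c : (0 < k)%N ->
  dotH (phi k) (phisum m c) = if (k <= m)%N then c k else 0.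
Proof.
move=> k0; have D i : (0 < i)%N -> dotH (phi k) (c i *: phi i) = c i * (k == i)%:R.
  by move=> i0; rewrite dotHZr phi_orthonormal.
rewrite /phisum dotH_sumr; have [km|km] := leqP k m.
  rewrite (bigD1_seq k) ?mem_index_iota ?k0 ?iota_uniq//=.
  rewrite D// eqxx mulr1 big1_seq ?addr0// => i.
  rewrite mem_index_iota => /andP[ik /andP[i0 _]].
  by rewrite D// eq_sym (negbTE ik) mulr0.
rewrite big1_seq// => i; rewrite mem_index_iota => /andP[_ /andP[i0 im]].
rewrite D//; case: eqP => [ki|_]; last by rewrite mulr0.
by move: km; rewrite ki ltnNge -ltnS im.
Qed.

Lemma projHP m (a : R[i]) psi chi : projH m (a *: psi + chi) = a *: projH m psi + projH m chi.
Proof. by rewrite !projHE -phisumP; apply: eq_phisum => k _; rewrite dotHPr. Qed.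

Lemma projH_phisum m n c : (m <= n)%N -> projH n (phisum m c) = phisum m c.
Proof.
move=> mn; rewrite projHE /phisum (@big_cat_nat _ _ _ m.+1)//=.
rewrite [X in _ + X]big1_seq ?addr0; last first.
  move=> k; rewrite mem_index_iota => /andP[_ /andP[mk kn]].
  rewrite -/(phisum m c) dotH_phi_phisum; last exact: leq_trans mk.
  by rewrite leqNgt mk scale0r.
apply: eq_big_nat => k /andP[k0 km]; rewrite -/(phisum m c) dotH_phi_phisum//.
by rewrite -ltnS km.
Qed.

Lemma projH_id m n psi : (m <= n)%N -> projH n (projH m psi) = projH m psi.
Proof. by move=> mn; rewrite projHE; exact: projH_phisum. Qed.

Lemma projH_sym m psi chi : dotH (projH m psi) chi = dotH psi (projH m chi).
Proof.
rewrite /projH dotH_suml dotH_sumr; apply: eq_bigr => k _.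
by rewrite dotHZl dotHZr -dotHC mulrC.
Qed.

Lemma rdot_projH m psi chi : rdot (projH m psi) chi = rdot psi (projH m chi).
Proof. by rewrite /rdot projH_sym. Qed.

Lemma projHZ m (r : R[i]) psi : projH m (r *: psi) = r *: projH m psi.
Proof.
by rewrite !projHE /phisum scaler_sumr; apply: eq_bigr => k _; rewrite dotHZr scalerA.
Qed.

Lemma projHD m psi chi : projH m (psi + chi) = projH m psi + projH m chi.
Proof. by rewrite -[psi]scale1r projHP !scale1r. Qed.

Lemma projHN m psi : projH m (- psi) = - projH m psi.
Proof. by rewrite -scaleN1r projHZ scaleN1r. Qed.

Lemma projHB m psi chi : projH m (psi - chi) = projH m psi - projH m chi.
Proof. by rewrite projHD projHN. Qed.

Lemma normH_projH m psi : normH (projH m psi) <= normH psi.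
Proof.
have [->|p0] := eqVneq (normH (projH m psi)) 0; first exact: normH_ge0.
have pp : 0 < normH (projH m psi) by rewrite lt0r p0 normH_ge0.
rewrite -(ler_pM2l pp) -expr2 normH_sqr rdot_projH projH_id// rdotC.
exact: rdot_le.
Qed.

Lemma normH_projHC m psi : normH (psi - projH m psi) <= normH psi.
Proof.
rewrite -(@ler_pXn2r _ 2)// ?nnegrE ?normH_ge0// !normH_sqr.
rewrite rdotBl !rdotBr (rdotC (projH m psi) psi).
rewrite [rdot (projH m psi) _]rdot_projH projH_id// subrr subr0.
by rewrite gerBl -(projH_id psi (leqnn m)) -rdot_projH -normH_sqr sqr_ge0.
Qed.

Definition A_eigenvalue k : R[i] := 0 -i* (k%:R ^+ 2 / 2).

(** The eigenvalues are purely imaginary. *)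
Lemma dotH_phisum_skew m psi chi :
  dotH (phisum m (fun k => A_eigenvalue k * dotH (phi k) psi)) chi =
  - dotH psi (phisum m (fun k => A_eigenvalue k * dotH (phi k) chi)).
Proof.
rewrite /phisum dotH_suml dotH_sumr -sumrN; apply: eq_bigr => k _.
rewrite dotHZl dotHZr (dotHC (phi k) psi) /A_eigenvalue.
case: (dotH (phi k) psi) (dotH (phi k) chi) => [a b] [c d]; simpc.
by congr (_ +i* _); ring.
Qed.

End Projections.

(** * Convergence and differentiation in the Hilbert space *)

Section Convergence.
Context (R : realType).
Local Notation H := (Hbox R).
Implicit Types (psi chi : H) (r : R[i]).

Lemma cvg0_dominated (F : set_system R) (f u : R -> R) : Filter F ->
  (\forall h \near F, `|f h| <= u h) -> u @ F --> (0 : R) -> f @ F --> (0 : R).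
Proof.
move=> FF fu u0; apply: (@squeeze_cvgr _ _ _ _ (fun h => - u h) u) => //.
  by apply: filterS fu => h; rewrite ler_norml.
by rewrite -oppr0; exact: cvgN.
Qed.

Lemma normHZc r psi : normH (r *: psi) = Num.sqrt (Re r ^+ 2 + Im r ^+ 2) * normH psi.
Proof.
apply/eqP; rewrite -(@eqrXn2 _ 2)// ?mulr_ge0 ?normH_ge0 ?sqrtr_ge0//.
rewrite exprMn !normH_sqr sqr_sqrtr ?addr_ge0 ?sqr_ge0// /rdot dotHZl dotHZr.
have : Im (dotH psi psi) = 0.
  by have := dotHC psi psi; case: (dotH psi psi) => a b /= [h]; lra.
by case: r (dotH psi psi) => [a b] [c d] /= ->; apply/eqP; ring.
Qed.

(** Joint continuity of the inner product, by expanding around the limits. *)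
Lemma cvgH_rdot (F : set_system R) (a_ b_ : R -> H) a b : Filter F ->
  cvgH a_ F a -> cvgH b_ F b -> (fun h => rdot (a_ h) (b_ h)) @ F --> rdot a b.
Proof.
move=> FF ha hb.
rewrite (_ : (fun h => _) = fun h => rdot (a_ h - a) (b_ h - b) +
   rdot (a_ h - a) b + rdot a (b_ h - b) + rdot a b); last first.
  by apply/funext => h; rewrite !(rdotBl, rdotBr); ring.
rewrite -[X in _ --> X]add0r; apply: cvgD; last exact: cvg_cst.
rewrite -[X in _ --> X]addr0; apply: cvgD.
  rewrite -[X in _ --> X]addr0; apply: cvgD.
    apply: (cvg0_dominated _ (u := fun h => normH (a_ h - a) * normH (b_ h - b))).
      by apply: nearW => h; exact: normr_rdot_le.
    by rewrite -(mulr0 (0 : R)); exact: cvgM.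
  apply: (cvg0_dominated _ (u := fun h => normH (a_ h - a) * normH b)).
    by apply: nearW => h; exact: normr_rdot_le.
  by rewrite -(mul0r (normH b)); apply: cvgM => //; exact: cvg_cst.
apply: (cvg0_dominated _ (u := fun h => normH a * normH (b_ h - b))).
  by apply: nearW => h; exact: normr_rdot_le.
by rewrite -(mulr0 (normH a)); apply: cvgM => //; exact: cvg_cst.
Qed.

Lemma cvgHP (F : set_system R) (a_ b_ : R -> H) a b r : Filter F ->
  cvgH a_ F a -> cvgH b_ F b -> cvgH (fun h => r *: a_ h + b_ h) F (r *: a + b).
Proof.
move=> FF ha hb; set c := Num.sqrt (Re r ^+ 2 + Im r ^+ 2).
apply: (cvg0_dominated _ (u := fun h => c * normH (a_ h - a) + normH (b_ h - b))).
  apply: nearW => h; rewrite ger0_norm ?normH_ge0// -normHZc scalerBr.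
  by rewrite opprD addrACA; exact: normHD.
rewrite -[X in _ --> X]addr0 -[X in X + _](mulr0 c); apply: cvgD => //.
by apply: cvgM => //; exact: cvg_cst.
Qed.

Definition quotH (x : R -> H) t : R -> H := fun h => (h^-1)%:C *: (x (t + h) - x t).

Lemma quotH_cvg (x : R -> H) t x' : cvgH (quotH x t) 0^' x' ->
  cvgH (fun h => x (t + h)) 0^' (x t).
Proof.
move=> hx.
apply: (cvg0_dominated _ (u := fun h => `|h| * (normH (quotH x t h - x') + normH x'))).
  near=> h; rewrite ger0_norm ?normH_ge0//.
  have h0 : h != 0 by near: h; exact: nbhs_dnbhs_neq.
  have -> : x (t + h) - x t = h%:C *: quotH x t h.
    rewrite /quotH scalerA -rmorphM mulfV// scale1r//.
  rewrite normHZ ler_wpM2l// -[X in normH X](subrK x'); exact: normHD.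
rewrite -[X in _ --> X](mul0r (0 + normH x')); apply: cvgM.
  rewrite -[X in _ --> X](normr0 R); apply: cvg_norm; apply: cvg_within_filter; exact: cvg_id.
by apply: cvgD => //; exact: cvg_cst.
Unshelve. all: by end_near. Qed.

Lemma is_derive_quot (f : R -> R) t l :
  (fun h => h^-1 * (f (t + h) - f t)) @ 0^' --> l -> is_derive t 1 f l.
Proof.
move=> hl.
have E : (fun h => h^-1 *: (f (h *: (1 : R) + t) - f t)) @ 0^' --> l.
  have -> : (fun h => h^-1 *: (f (h *: (1 : R) + t) - f t)) =
      (fun h => h^-1 * (f (t + h) - f t)).
    by apply/funext => h; rewrite /GRing.scale/= mulr1 (addrC h).
  exact: hl.
apply: DeriveDef; first by apply/cvg_ex; exists l.
by apply: cvg_lim E.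
Qed.

(** The product rule. The second factor of the first term is evaluated at t + h,
    so it needs the continuity given by [quotH_cvg]. *)
Lemma is_derive_rdot (x y : R -> H) t x' y' :
  cvgH (quotH x t) 0^' x' -> cvgH (quotH y t) 0^' y' ->
  is_derive t 1 (fun s => rdot (x s) (y s)) (rdot x' (y t) + rdot (x t) y').
Proof.
move=> hx hy; apply: is_derive_quot.
rewrite (_ : (fun h => _) = fun h => rdot (quotH x t h) (y (t + h)) +
    rdot (x t) (quotH y t h)).
  apply: cvgD; first by apply: cvgH_rdot => //; exact: quotH_cvg hy.
  apply: cvgH_rdot => //; rewrite /cvgH subrr normH0; exact: cvg_cst.
apply/funext => h; rewrite /quotH rdotZl rdotZr rdotBl rdotBr; ring.
Qed.

Lemma cvg_dnbhs0N (f : R -> R) (l : R) : f @ 0^' --> l ->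
  (fun h => f (- h)) @ 0^' --> l.
Proof.
move=> /cvgrPdist_lt fl; apply/cvgrPdist_lt => e e0.
have [d /= d0 hd] := fl e e0; exists d => //= h hh h0.
apply: hd; last by rewrite oppr_eq0.
by move: hh; rewrite /ball/= !sub0r opprK normrN.
Qed.

End Convergence.

(** * Orbits of unitary groups *)

Section UnitaryGroups.
Context (R : realType).
Local Notation H := (Hbox R).
Variables (D : set H) (G : H -> H) (U : R -> H -> H).
Hypothesis hU : generates D G U.
Implicit Types (psi chi : H) (t s : R).

(** Polarization of the isometry property. *)
Lemma unitary_rdot t psi chi : rdot (U t psi) (U t chi) = rdot psi chi.
Proof.
have [[lin iso _ _ _] _] := hU.
have E a b : rdot a b = (normH (a + b) ^+ 2 - normH a ^+ 2 - normH b ^+ 2) / 2.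
  by rewrite !normH_sqr rdotDl !rdotDr (rdotC b a); field.
have L : U t (psi + chi) = U t psi + U t chi by rewrite -[psi]scale1r lin !scale1r.
by rewrite !E -L !iso.
Qed.

Lemma unitary_adjoint t psi chi : rdot psi (U t chi) = rdot (U (- t) psi) chi.
Proof.
have [[_ _ U0 UD _] _] := hU.
by rewrite -(unitary_rdot (- t)) -UD addNr U0.
Qed.

Lemma unitary_cvg0 psi : (fun h => normH (U h psi - psi)) @ nbhs (0 : R) --> (0 : R).
Proof.
have [[lin iso U0 UD U1] _] := hU.
apply/cvgrPdist_lt => e e0; have /cvgrPdist_lt /(_ e e0) [d /= d0 hd] := U1 psi.
exists d => //= x hx; have [->|x0] := eqVneq x 0; last exact: hd.
by rewrite U0 subrr normH0 subrr normr0.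
Qed.

Lemma unitaryB t psi chi : U t psi - U t chi = U t (psi - chi).
Proof.
have [[lin iso U0 UD U1] _] := hU.
have -> : psi - chi = -1 *: chi + psi by rewrite scaleN1r addrC.
by rewrite lin scaleN1r addrC.
Qed.

Lemma unitary_continuous s psi : cvgH (U ^~ psi) (nbhs s) (U s psi).
Proof.
have [[lin iso U0 UD U1] _] := hU.
rewrite /cvgH (_ : (fun i => _) = (fun h => normH (U h psi - psi)) \o (fun t => t - s)).
  apply: (cvg_comp _ _ _ (unitary_cvg0 psi)).
  by rewrite -(subrr s); apply: cvgB; [exact: cvg_id|exact: cvg_cst].
apply/funext => t /=.
have -> : U t psi = U s (U (t - s) psi) by rewrite -UD addrC subrK.
by rewrite unitaryB iso.
Qed.

(** The difference quotient of the orbit is moved to the other side by the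
    adjoint U(-h), where it acts on y t, a vector in the domain. *)
Lemma is_derive_rdot_orbit (y : R -> H) t a y' chi : D (y t) ->
  cvgH (quotH y t) 0^' y' ->
  is_derive t 1 (fun s => rdot (y s) (U (s - a) chi))
    (rdot y' (U (t - a) chi) - rdot (G (y t)) (U (t - a) chi)).
Proof.
move=> Dy hy; have [[lin iso U0 UD U1] hG] := hU.
have hGy := (hG (y t) (G (y t))).2 (conj Dy erefl).
set psi := U (t - a) chi.
have E h : U (t + h - a) chi = U h psi by rewrite -UD addrAC addrC.
apply: is_derive_quot.
rewrite (_ : (fun h => _) = fun h => rdot (quotH y t h) (U h psi) -
    rdot ((- h)^-1%:C *: (U (- h) (y t) - y t)) psi).
  apply: cvgB; first exact: cvgH_rdot.
  apply: (@cvg_dnbhs0N R (fun h => rdot (h^-1%:C *: (U h (y t) - y t)) psi)).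
  apply: cvgH_rdot => //; rewrite /cvgH subrr normH0; exact: cvg_cst.
apply/funext => h; rewrite /quotH !rdotZl !rdotBl E -unitary_adjoint invrN -/psi.
ring.
Qed.

End UnitaryGroups.

Lemma scale0C (R : realType) (psi : Hbox R) : (0 : R)%:C *: psi = 0.
Proof. exact: scale0r. Qed.

(** * Galerkin approximations *)

Section GeneratorDomain.
Context (R : realType).
Local Notation H := (Hbox R).
Local Notation phi := (phi R).
Variables (D : set H) (A B : H -> H) (U : R -> H -> H).
Hypothesis hU : generates D (fun psi => A psi + (0 : R)%:C *: B psi) U.
Implicit Types (psi chi : H) (r : R[i]) (c : nat -> R[i]).

(** The domain of a generator is the set of vectors with a differentiable orbit,
    hence a subspace on which the generator is linear. For A this yields
    linearity without going through weak derivatives. *)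
Lemma generator_lin r psi1 psi2 : D psi1 -> D psi2 ->
  D (r *: psi1 + psi2) /\ A (r *: psi1 + psi2) = r *: A psi1 + A psi2.
Proof.
move=> D1 D2; have [[lin _ _ _ _] hG] := hU.
have c1 := (hG psi1 _).2 (conj D1 erefl); have c2 := (hG psi2 _).2 (conj D2 erefl).
have := cvgHP r _ c1 c2.
rewrite (_ : (fun h => _) = fun h : R => (h^-1)%:C *:
    (U h (r *: psi1 + psi2) - (r *: psi1 + psi2))); last first.
  apply/funext => h; rewrite lin scalerA mulrC -scalerA -scalerDr; congr (_ *: _).
  by rewrite scalerBr opprD addrACA.
move=> h; have [d] := (hG _ _).1 (h _).
by rewrite !scale0C !addr0 => ->.
Qed.

Lemma generator_phisum (l : nat -> R[i]) : (forall k, D (phi k)) ->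
  (forall k, A (phi k) = l k *: phi k) -> forall m c, D (phisum m c) /\
  A (phisum m c) = phisum m (fun k => c k * l k).
Proof.
move=> Dphi Aphi m c.
have [D0 A0] : D 0 /\ A 0 = 0.
  by have := generator_lin (-1) (Dphi 1%N) (Dphi 1%N); rewrite !scaleN1r !addNr.
elim: m => [|m [Dm Am]]; first by rewrite /phisum !big_geq.
have S c' : phisum m.+1 c' = c' m.+1 *: phi m.+1 + phisum m c'.
  by rewrite /phisum big_nat_recr//= addrC.
have [D' A'] := generator_lin (c m.+1) (Dphi m.+1) Dm.
by rewrite !S; split => //; rewrite A' Am Aphi scalerA.
Qed.

End GeneratorDomain.

Lemma domA_phisum (R : realType) (U : R -> Hbox R -> Hbox R) :
  generates (@domA R) (fun psi => opA psi + (0 : R)%:C *: opB psi) U ->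
  forall m c, domA (phisum m c) /\
  opA (phisum m c) = phisum m (fun k => c k * A_eigenvalue R k).
Proof.
move=> hU; exact: (generator_phisum hU (@domA_phi R) (@opA_phi R)).
Qed.

Section Galerkin.
Context (R : realType).
Local Notation H := (Hbox R).
Local Notation phi := (phi R).
Variable U : R -> H -> H.
Hypothesis hU : generates (@domA R) (fun psi => opA psi + (0 : R)%:C *: opB psi) U.
Variable N : nat.
Implicit Types (psi chi : H) (v : R).

(** The right-hand side of the Galerkin system for the constant control v. *)
Definition galerkin_field v psi : H := opAN N psi + v%:C *: opBN N psi.

Lemma domA_projH psi : domA (projH N psi).
Proof. by have [] := domA_phisum hU N (fun k => dotH (phi k) psi). Qed.

Lemma opA_projH psi :
  opA (projH N psi) = phisum N (fun k => A_eigenvalue R k * dotH (phi k) psi).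
Proof.
rewrite projHE; have [_ ->] := domA_phisum hU N (fun k => dotH (phi k) psi).
by apply: eq_phisum => k _; rewrite mulrC.
Qed.

Lemma opANE psi : opAN N psi = phisum N (fun k => A_eigenvalue R k * dotH (phi k) psi).
Proof. by rewrite /opAN opA_projH projH_phisum. Qed.

(** The range of the projection is invariant under A. *)
Lemma opAN_projH psi : opAN N psi = opA (projH N psi).
Proof. by rewrite opANE opA_projH. Qed.

Lemma rdot_opB psi chi : rdot (opB psi) chi = - rdot psi (opB chi).
Proof. by rewrite /rdot opB_skew; case: (dotH _ _). Qed.

Lemma galerkin_field_skew v psi chi :
  rdot (galerkin_field v psi) chi = - rdot psi (galerkin_field v chi).
Proof.
rewrite /galerkin_field rdotDl rdotDr rdotZl rdotZr opprD -mulrN; congr (_ + _ * _).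
  by rewrite !opANE /rdot dotH_phisum_skew; case: (dotH _ _).
by rewrite /opBN rdot_projH rdot_opB rdot_projH.
Qed.

Lemma projH_galerkin_field v psi : projH N (galerkin_field v psi) = galerkin_field v psi.
Proof.
rewrite /galerkin_field projHD projHZ /opBN projH_id// opANE projH_phisum//.
Qed.

End Galerkin.

Section Piecewise.
Context (R : realType).
Implicit Types (u : R -> R) (a b c s t T : R).

(** By induction along the partition. It carries both conserved quantities and
    integral bounds across the jumps of u. *)
Lemma piecewise_ind T u (Q : R -> R -> Prop) : piecewise_constant T u ->
  (forall a b v, 0 <= a -> a <= b -> b <= T ->
     (forall x, a < x < b -> u x = v) -> Q a b) ->
  (forall a b c, 0 <= a -> a <= b -> b <= c -> c <= T -> Q a b -> Q b c -> Q a c) ->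
  forall t, 0 <= t <= T -> Q 0 t.
Proof.
move=> [s sP su] base trans.
have nthT i : (i <= size s)%N -> nth 0 (0 :: s) i <= T.
  by move=> hi; rewrite (set_nth_default T)//; exact: itv_partition_nth_le.
have nth0 i : (i <= size s)%N -> 0 <= nth 0 (0 :: s) i.
  by move=> hi; rewrite (set_nth_default T)//; exact: itv_partition_nth_ge.
have step i : (i <= size s)%N -> forall t, 0 <= t -> t <= nth 0 (0 :: s) i -> Q 0 t.
  elim: i => [_ t t0 tle|i IH hi t t0 tle].
    apply: (base 0 t 0) => //; first exact: le_trans tle (nthT _ (leq0n _)).
    by move=> x /andP[x0 xt]; have := lt_trans x0 (lt_le_trans xt tle); rewrite ltxx.
  have [ti|ti] := leP t (nth 0 (0 :: s) i); first exact: IH (ltnW hi) _ t0 ti.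
  have tT : t <= T by apply: le_trans tle (nthT _ hi).
  have [v hv] := su i hi.
  apply: (trans 0 (nth 0 (0 :: s) i) t) => //.
  - exact: nth0 (ltnW hi).
  - exact: ltW.
  - by apply: IH => //; [exact: ltnW|exact: nth0 (ltnW hi)].
  - apply: (base _ _ v) => //; [exact: nth0 (ltnW hi)|exact: ltW|].
    by move=> x /andP[x1 x2]; apply: hv; rewrite x1 (lt_le_trans x2 tle).
move=> t /andP[t0 tT]; apply: (step (size s)) => //.
by rewrite (itv_partition_nth_size _ sP).
Qed.

End Piecewise.

Section GalerkinSolutions.
Context (R : realType).
Local Notation H := (Hbox R).
Variable U : R -> H -> H.
Hypothesis hU : generates (@domA R) (fun psi => opA psi + (0 : R)%:C *: opB psi) U.
Variables (N : nat) (T : R) (u : R -> R).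
Hypothesis hu : piecewise_constant T u.
Implicit Types (x y z : R -> H) (a b s t v : R).

Local Notation sol := (galerkin_solution N T u).

Lemma near_itvoo a b t : a < t < b -> \forall s \near t, a < s < b.
Proof.
move=> /andP[h1 h2]; near=> s; apply/andP; split.
  by near: s; exact: lt_nbhsr.
by near: s; exact: lt_nbhsl.
Unshelve. all: by end_near. Qed.

Lemma sol_quot x a b v t : sol x -> 0 <= a -> b <= T ->
  (forall s, a < s < b -> u s = v) -> a < t < b ->
  cvgH (quotH x t) 0^' (galerkin_field N v (x t)).
Proof.
move=> [_ sx] a0 bT uv tab; rewrite -(uv t tab); apply: sx.
  by case/andP: tab => h1 h2; rewrite (le_lt_trans a0 h1) (lt_le_trans h2 bT).
by apply: filterS (near_itvoo tab) => s hs; rewrite !uv.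
Qed.

Lemma sol_within x a b t : sol x -> 0 <= a -> b <= T -> a <= t <= b ->
  cvgH x (within `[a, b] (nbhs t)) (x t).
Proof.
move=> [cx _] a0 bT /andP[h1 h2].
have tT : 0 <= t <= T by rewrite (le_trans a0 h1) (le_trans h2 bT).
have := cx t tT; apply: cvg_trans; apply: cvg_app; apply: within_subset.
move=> s /=; rewrite !in_itv/= => /andP[s1 s2].
by rewrite (le_trans a0 s1) (le_trans s2 bT).
Qed.

(** The derivative of the pairing vanishes on each piece by
    [galerkin_field_skew], and the pairing is continuous across the jumps. *)
Lemma sol_rdot0 x y t : sol x -> sol y -> 0 <= t <= T ->
  rdot (x t) (y t) = rdot (x 0) (y 0).
Proof.
move=> sx sy ht.
apply: (piecewise_ind (Q := fun a b => rdot (x b) (y b) = rdot (x a) (y a)) hu) ht; last first.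
  by move=> a b c _ _ _ _ <- ->.
move=> a b v a0 ab bT uv.
have [||c _] := @MVT_segment R (fun s => rdot (x s) (y s)) (fun=> 0) a b ab.
- move=> s; rewrite in_itv/= => sab.
  apply: (is_derive_eq (is_derive_rdot (sol_quot sx a0 bT uv sab) (sol_quot sy a0 bT uv sab))).
  by rewrite (galerkin_field_skew hU) addNr.
- apply/subspace_continuousP => s /=; rewrite in_itv/= => sab.
  by apply: cvgH_rdot; exact: sol_within.
by rewrite mul0r => /eqP; rewrite subr_eq0 => /eqP.
Qed.

Lemma sol_rdot x y s t : sol x -> sol y -> 0 <= s <= T -> 0 <= t <= T ->
  rdot (x t) (y t) = rdot (x s) (y s).
Proof. by move=> sx sy hs ht; rewrite !(sol_rdot0 sx sy). Qed.

Lemma sol_norm x s t : sol x -> 0 <= s <= T -> 0 <= t <= T ->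
  normH (x t) = normH (x s).
Proof.
move=> sx hs ht; apply/eqP; rewrite -(@eqrXn2 _ 2)// ?normH_ge0// !normH_sqr.
by rewrite (sol_rdot sx sx hs ht).
Qed.

(** Uniqueness and linearity at once: the square norm of z - (r x + y) is a
    combination of pairings of solutions, all of which are conserved. *)
Lemma sol_lin x y z (r : R) s t : sol x -> sol y -> sol z ->
  0 <= s <= T -> 0 <= t <= T ->
  z s = r%:C *: x s + y s -> z t = r%:C *: x t + y t.
Proof.
move=> sx sy sz hs ht e; apply/eqP; rewrite -subr_eq0; apply/eqP.
have E q : rdot (z q - (r%:C *: x q + y q)) (z q - (r%:C *: x q + y q)) =
   rdot (z q) (z q) + r ^+ 2 * rdot (x q) (x q) + rdot (y q) (y q)
   - 2 * r * rdot (z q) (x q) - 2 * rdot (z q) (y q) + 2 * r * rdot (x q) (y q).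
  rewrite !(rdotBl, rdotBr, rdotDl, rdotDr, rdotZl, rdotZr).
  by rewrite (rdotC (x q) (z q)) (rdotC (y q) (z q)) (rdotC (y q) (x q)); ring.
apply: dotH_eq0; rewrite -[LHS]/(rdot _ _) E.
rewrite (sol_rdot sx sx hs ht) (sol_rdot sy sy hs ht) (sol_rdot sz sz hs ht).
rewrite (sol_rdot sz sx hs ht) (sol_rdot sz sy hs ht) (sol_rdot sx sy hs ht).
by rewrite -E e subrr rdot0l.
Qed.

Lemma sol_eq x y s t : sol x -> sol y -> 0 <= s <= T -> 0 <= t <= T ->
  x s = y s -> x t = y t.
Proof.
move=> sx sy hs ht e; have := @sol_lin x y y 0 s t sx sy sy hs ht.
have h := @sol_lin y x y 0 s t sy sx sy hs ht.
by rewrite h ?scale0C ?add0r//; rewrite scale0C add0r.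
Qed.

(** The component of a solution orthogonal to the range of the projection is
    constant, because the field takes its values in that range. *)
Lemma sol_projH x s t : sol x -> 0 <= s <= T -> 0 <= t <= T ->
  projH N (x s) = x s -> projH N (x t) = x t.
Proof.
move=> sx hs ht e.
have C w q : 0 <= q <= T ->
    rdot (w - projH N w) (x q) = rdot (w - projH N w) (x 0).
  move=> hq; set w' := w - projH N w.
  apply: (piecewise_ind (Q := fun a b => rdot w' (x b) = rdot w' (x a)) hu) hq; last first.
    by move=> a b c _ _ _ _ <- ->.
  move=> a b v a0 ab bT uv.
  have q0 p : cvgH (quotH (fun=> w') p) 0^' 0.
    rewrite /cvgH /quotH (_ : (fun i => _) = cst 0); first exact: cvg_cst.
    by apply/funext => h; rewrite !subrr scaler0 subrr normH0.
  have [||c _] := @MVT_segment R (fun p => rdot w' (x p)) (fun=> 0) a b ab.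
  - move=> p; rewrite in_itv/= => pab.
    apply: (is_derive_eq (is_derive_rdot (q0 p) (sol_quot sx a0 bT uv pab))).
    rewrite rdot0l add0r -(projH_galerkin_field hU) -rdot_projH.
    by rewrite projHB projH_id// subrr rdot0l.
  - apply/subspace_continuousP => p /=; rewrite in_itv/= => pab.
    apply: cvgH_rdot; last exact: sol_within pab.
    by rewrite /cvgH subrr normH0; exact: cvg_cst.
  by rewrite mul0r => /eqP; rewrite subr_eq0 => /eqP.
have Z w q : rdot (w - projH N w) (projH N q) = 0.
  by rewrite -rdot_projH projHB projH_id// subrr rdot0l.
apply/esym/eqP; rewrite -subr_eq0; apply/eqP/dotH_eq0; rewrite -[LHS]/(rdot _ _).
by rewrite rdotBr Z subr0 C// -(C _ s)// -e Z.
Qed.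

End GalerkinSolutions.

(** * Operator norms *)

Section OperatorNorm.
Context (R : realType).
Local Notation H := (Hbox R).
Implicit Types (L : H -> H) (psi : H) (M : R).

Lemma opnorm_ub L M : (forall psi, normH psi <= 1 -> normH (L psi) <= M) ->
  (opnorm L <= M%:E)%E.
Proof. by move=> h; apply: ge_ereal_sup => _ [psi /= h1 <-]; rewrite lee_fin h. Qed.

Lemma opnorm_ge L psi : normH psi <= 1 -> ((normH (L psi))%:E <= opnorm L)%E.
Proof. by move=> h; apply: ereal_sup_ubound; exists psi. Qed.

Lemma opnorm_ge0 L : (0 <= opnorm L)%E.
Proof.
by apply: (@le_trans _ _ (normH (L 0))%:E); [rewrite lee_fin normH_ge0|apply: opnorm_ge; rewrite normH0].
Qed.

Lemma opnorm_fin L M : (forall psi, normH psi <= 1 -> normH (L psi) <= M) ->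
  opnorm L \is a fin_num.
Proof.
move=> h; rewrite ge0_fin_numE ?opnorm_ge0//.
by apply: (le_lt_trans (opnorm_ub h)); exact: ltry.
Qed.

(** By rescaling psi to the unit sphere. *)
Lemma opnorm_le L psi : (forall (r : R) chi, L (r%:C *: chi) = r%:C *: L chi) ->
  opnorm L \is a fin_num -> normH (L psi) <= fine (opnorm L) * normH psi.
Proof.
move=> hL fL; have [p0|p0] := eqVneq (normH psi) 0.
  have := hL 0 psi; rewrite (normH_eq0 p0) !scale0C => ->.
  by rewrite normH0 mulr0.
have pp : 0 < normH psi by rewrite lt0r p0 normH_ge0.
have ip : 0 <= (normH psi)^-1 by rewrite invr_ge0 ltW.
have e : (normH psi)^-1 * normH (L psi) = normH (L ((normH psi)^-1%:C *: psi)).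
  by rewrite hL normHZ ger0_norm.
rewrite -ler_pdivrMr// mulrC e -lee_fin fineK//; apply: opnorm_ge.
by rewrite normHZ ger0_norm// mulVf.
Qed.

End OperatorNorm.

(** * Pairing of a Galerkin solution with the exact evolution *)

Section Propagator.
Context (R : realType).
Local Notation H := (Hbox R).
Local Notation leb := (@lebesgue_measure R).
Variables (N : nat) (T : R) (u : R -> R) (U : R -> R -> H -> H) (Y : R -> H -> H).
Hypothesis hu : piecewise_constant T u.
Hypothesis hU : forall v, generates (@domA R) (fun psi => opA psi + v%:C *: opB psi) (U v).
Hypothesis Y0 : forall psi, Y 0 psi = psi.
Hypothesis YU : forall s t v, 0 <= s -> s <= t -> t <= T ->
  (forall x, s < x < t -> u x = v) -> forall psi, Y t psi = U v (t - s) (Y s psi).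
Implicit Types (psi chi : H) (a b s t v : R).

(** Each piece of the evolution is isometric. *)
Lemma propagator_norm t psi : 0 <= t <= T -> normH (Y t psi) = normH psi.
Proof.
move=> ht; rewrite -[in RHS](Y0 psi).
apply: (piecewise_ind (Q := fun a b => normH (Y b psi) = normH (Y a psi)) hu) ht; last first.
  by move=> a b c _ _ _ _ <- ->.
move=> a b v a0 ab bT uv; have [[_ iso _ _ _] _] := hU v.
by rewrite (YU a0 ab bT uv) iso.
Qed.

Variables (y : R -> H) (K : R).
Hypothesis sy : galerkin_solution N T u y.
Hypothesis Py : forall s, 0 <= s <= T -> projH N (y s) = y s.
Hypothesis yK : forall s psi, 0 <= s <= T -> normH psi <= 1 ->
  `|rdot (y s) (opB (psi - projH N psi))| <= K.
Variable psi0 : H.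
Hypothesis psi0_le1 : normH psi0 <= 1.

(** With psi(s) the orbit, the derivative of the pairing is rdot (field (y s))
    (psi s) - rdot (A y + v B y) (psi s), where field is the Galerkin field.
    Since y s is fixed by the projection, the terms in A are equal, and what is
    left is v rdot (pi_N B y - B y) (psi s), in which pi_N and B are moved to
    the right. The mean value theorem concludes. *)
Lemma pairing_piece a b v : 0 <= a -> a <= b -> b <= T ->
  (forall x, a < x < b -> u x = v) ->
  `|rdot (y b) (Y b psi0) - rdot (y a) (Y a psi0)| <= K * (`|v| * (b - a)).
Proof.
move=> a0 ab bT uv; have [[_ iso U0 _ _] _] := hU v.
pose psi s := U v (s - a) (Y a psi0).
have Ea : Y a psi0 = psi a by rewrite /psi subrr U0.
have Eb : Y b psi0 = psi b by exact: YU.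
have psi1 s : normH (psi s) <= 1.
  rewrite /psi iso propagator_norm//.
  by rewrite a0 (le_trans ab).
have [||c] := @MVT_segment R (fun s => rdot (y s) (psi s))
  (fun s => v * rdot (y s) (opB (psi s - projH N (psi s)))) a b ab.
- move=> s; rewrite in_itv/= => sab.
  have s0T : 0 <= s <= T.
    by case/andP: sab => h1 h2; rewrite (le_trans a0 (ltW h1)) (le_trans (ltW h2) bT).
  have Dy : domA (y s) by rewrite -(Py s0T); exact: (domA_projH (hU 0)).
  apply: (is_derive_eq (is_derive_rdot_orbit (hU v) a (Y a psi0) Dy (sol_quot sy a0 bT uv sab))).
  rewrite -/(psi s) /galerkin_field (opAN_projH (hU 0)) (Py s0T) /opBN (Py s0T).
  rewrite !rdotDl !rdotZl rdot_projH !rdot_opB.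
  have P : rdot (y s) (opB (psi s - projH N (psi s))) =
      rdot (y s) (opB (psi s)) - rdot (y s) (opB (projH N (psi s))).
    have -> : psi s - projH N (psi s) = -1 *: projH N (psi s) + psi s.
      by rewrite scaleN1r addrC.
    by rewrite opBP scaleN1r addrC rdotBr.
  by rewrite P; ring.
- apply/subspace_continuousP => s /=; rewrite in_itv/= => sab.
  apply: cvgH_rdot; first exact: (sol_within sy a0 bT sab).
  apply: cvg_within_filter; rewrite /psi.
  apply: (cvg_comp (fun t => t - a) (fun h => normH (U v h (Y a psi0) - U v (s - a) (Y a psi0)))).
    by apply: cvgB; [exact: cvg_id|exact: cvg_cst].
  exact: (unitary_continuous (hU v)).
rewrite in_itv/= Ea Eb => cab ->.
have c0T : 0 <= c <= T.
  by case/andP: cab => h1 h2; rewrite (le_trans a0 h1) (le_trans h2 bT).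
have ba : 0 <= b - a by rewrite subr_ge0.
rewrite !normrM (ger0_norm ba) mulrA ler_wpM2r// mulrC.
by rewrite ler_wpM2r// yK.
Qed.

(** The estimates on the pieces add up to an integral; measurability of u is
    carried along, since additivity of the integral requires it. *)
Lemma pairing_le t : 0 <= t <= T -> measurable_fun `[0, t] u /\
  ((`|rdot (y t) (Y t psi0) - rdot (y 0) psi0|)%:E <=
   K%:E * \int[leb]_(x in `[0%R, t]) `|u x|%:E)%E.
Proof.
move=> ht; rewrite -[in rdot _ psi0](Y0 psi0).
have K0 : 0 <= K.
  by apply: le_trans (normr_ge0 _) (yK (psi := 0) ht _); rewrite normH0.
apply: (piecewise_ind (Q := fun a b => measurable_fun `[a, b] u /\
  ((`|rdot (y b) (Y b psi0) - rdot (y a) (Y a psi0)|)%:E <=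
   K%:E * \int[leb]_(x in `[a, b]) `|u x|%:E)%E) hu) ht.
- move=> a b v a0 ab bT uv.
  have moo : measurable_fun `]a, b[ u.
    apply: (@eq_measurable_fun _ _ _ _ _ (cst v)) => // x.
    by rewrite inE/= in_itv/= => /uv.
  split; first exact: measurable_fun_itv_cc moo.
  rewrite integral_itv_bndoo; last by apply/measurable_EFinP; exact: measurableT_comp.
  rewrite (eq_integral (fun=> `|v|%:E)); last first.
    by move=> x; rewrite inE/= in_itv/= => /uv ->.
  rewrite integral_cst//= lebesgue_measure_itv/= lte_fin.
  have h := pairing_piece a0 ab bT uv.
  case: ifPn => hab; first by rewrite -EFinB -!EFinM lee_fin.
  have e : b = a by apply/eqP; rewrite eq_le ab leNgt hab.
  by rewrite e subrr normr0 !mule0.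
- move=> a b c a0 ab bc cT [m1 h1] [m2 h2].
  have E : `[a, c]%classic = `[a, b] `|` `]b, c].
    by apply: itv_bndbnd_setU; rewrite bnd_simp.
  have m2' : measurable_fun `]b, c] u.
    by apply: measurable_funS m2 => //; apply: subset_itvr; rewrite bnd_simp.
  have mac : measurable_fun `[a, c] u by rewrite E; apply/measurable_funU.
  split=> //; rewrite E ge0_integral_setU//=; last 2 first.
  - by rewrite -E; apply/measurable_EFinP; exact: measurableT_comp.
  - apply/disj_setPS => x [/=]; rewrite !in_itv/= => /andP[_ h] /andP[h' _].
    by move: (le_lt_trans h h'); rewrite ltxx.
  rewrite integral_itv_obnd_cbnd; last first.
    by apply/measurable_EFinP; exact: measurableT_comp.
  rewrite ge0_muleDr ?integral_ge0//.
  apply: le_trans (leeD h1 h2); rewrite -EFinD lee_fin.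
  rewrite (_ : _ - _ = (rdot (y b) (Y b psi0) - rdot (y a) (Y a psi0)) +
     (rdot (y c) (Y c psi0) - rdot (y b) (Y b psi0))); last by ring.
  exact: ler_normD.
Qed.

End Propagator.

(** * Commutators of the Galerkin propagator with projections *)

Section Commutator.
Context (R : realType).
Local Notation H := (Hbox R).
Variables (N m : nat) (T : R) (u : R -> R) (X : R -> R -> H -> H) (U : R -> H -> H).
Hypothesis T0 : 0 <= T.
Hypothesis hu : piecewise_constant T u.
Hypothesis hX : is_galerkin_propagator N T u X.
Hypothesis hU : generates (@domA R) (fun psi => opA psi + (0 : R)%:C *: opB psi) U.
Implicit Types (psi chi : H) (s t : R).

Local Notation P := (@projH R m).
Local Notation sol := (galerkin_solution N T u).

Definition commX s psi : H := P (X s 0 psi) - X s 0 (P psi).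

Let itv0 : (0 : R) <= 0 <= T. Proof. by rewrite lexx. Qed.

Lemma sol_X s psi : 0 <= s <= T -> sol (fun t => X t s psi).
Proof. by move=> hs; case: (hX hs psi). Qed.

Lemma X_id s psi : 0 <= s <= T -> X s s psi = psi.
Proof. by move=> hs; case: (hX hs psi). Qed.

Lemma X_norm s t psi : 0 <= s <= T -> 0 <= t <= T -> normH (X t s psi) = normH psi.
Proof.
by move=> hs ht; rewrite (sol_norm hU hu (sol_X psi hs) hs ht) X_id.
Qed.

(** All sides are solutions, and the relation holds at time s. *)
Lemma X_lin s t (r : R) psi chi : 0 <= s <= T -> 0 <= t <= T ->
  X t s (r%:C *: psi + chi) = r%:C *: X t s psi + X t s chi.
Proof.
move=> hs ht; have S w := sol_X w hs.
by apply: (sol_lin hU hu (S psi) (S chi) (S _) hs ht); rewrite !X_id.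
Qed.

Lemma X0 s t : 0 <= s <= T -> 0 <= t <= T -> X t s 0 = 0.
Proof. by move=> hs ht; apply: normH_eq0; rewrite X_norm// normH0. Qed.

Lemma X_scale s t (r : R) psi : 0 <= s <= T -> 0 <= t <= T ->
  X t s (r%:C *: psi) = r%:C *: X t s psi.
Proof. by move=> hs ht; rewrite -[r%:C *: psi]addr0 X_lin// X0// addr0. Qed.

Lemma XB s t psi chi : 0 <= s <= T -> 0 <= t <= T ->
  X t s (psi - chi) = X t s psi - X t s chi.
Proof.
move=> hs ht; have E w1 w2 : w1 - w2 = (-1 : R)%:C *: w2 + w1 :> H.
  by rewrite rmorphN rmorph1 scaleN1r addrC.
by rewrite !E X_lin.
Qed.

(** Both sides are solutions, and they agree at time 0. *)
Lemma X_flow s t chi : 0 <= s <= T -> 0 <= t <= T ->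
  X s 0 (X 0 t chi) = X s t chi.
Proof.
move=> hs ht; have S1 := sol_X (X 0 t chi) itv0; have S2 := sol_X chi ht.
by apply: (sol_eq hU hu S1 S2 itv0 hs); rewrite X_id.
Qed.

Lemma commX_scale s (r : R) psi : 0 <= s <= T ->
  commX s (r%:C *: psi) = r%:C *: commX s psi.
Proof.
by move=> hs; rewrite /commX projHZ !X_scale// projHZ scalerBr.
Qed.

Lemma commX_le2 s psi : 0 <= s <= T -> normH psi <= 1 -> normH (commX s psi) <= 2.
Proof.
move=> hs h; apply: (le_trans (normHD _ _)); rewrite normHN X_norm//.
rewrite -[2]/(1 + 1); apply: lerD; last exact: le_trans (normH_projH m psi) h.
by apply: (le_trans (normH_projH m _)); rewrite X_norm.
Qed.

Variables (c : R).
Hypothesis hc : forall s psi, 0 <= s <= T -> normH (commX s psi) <= c * normH psi.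

(** Writing v for the value at time 0 of the solution equal to chi at time t,
    this is the decomposition X s t chi = P X(s,0) v - [P, X(s,0)] v + X(s,0) (v
    - P v), in which the last term has the norm of the commutator at time t
    because X(t,0) v = chi is fixed by P. *)
Lemma rdot_X_projH_le (w chi : H) s t : 0 <= s <= T -> 0 <= t <= T -> P chi = chi ->
  `|rdot (X s t chi) w| <= normH chi * (normH (P w) + 2 * normH w * c).
Proof.
move=> hs ht Pchi; set v := X 0 t chi.
have nv : normH v = normH chi by exact: X_norm.
have E1 : X t 0 v = chi by rewrite /v X_flow// X_id.
have E : X s t chi = P (X s 0 v) - commX s v + X s 0 (v - P v).
  by rewrite /commX subKr XB// subrKC /v X_flow.
have n3 : normH (X s 0 (v - P v)) <= c * normH chi.
  have e : X t 0 (v - P v) = commX t v by rewrite XB// /commX E1 Pchi.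
  by rewrite X_norm// -(X_norm (v - P v) itv0 ht) e -nv hc.
rewrite E rdotDl rdotBl rdot_projH.
have K (n p q : R) : n * (p + 2 * q * c) = n * p + c * n * q + c * n * q by ring.
rewrite K; apply: (le_trans (ler_normD _ _)); apply: lerD; last first.
  exact: le_trans (normr_rdot_le _ _) (ler_wpM2r (normH_ge0 w) n3).
apply: (le_trans (ler_normB _ _)); apply: lerD.
  by apply: (le_trans (normr_rdot_le _ _)); rewrite X_norm// nv.
rewrite -nv.
exact: le_trans (normr_rdot_le _ _) (ler_wpM2r (normH_ge0 w) (hc v hs)).
Qed.

End Commutator.

(** The case d = 0 is separate because d is cancelled; I may be infinite. *)
Lemma cancel_norm (R : realType) (d k : R) (I : \bar R) : 0 <= d -> 0 <= k ->
  (0 <= I)%E -> ((d * d)%:E <= (d * k)%:E * I)%E -> (d%:E <= I * k%:E)%E.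
Proof.
move=> d0 k0 I0; have [->|dn] := eqVneq d 0; first by rewrite mule_ge0// lee_fin.
have dp : 0 < d by rewrite lt0r dn d0.
by rewrite !EFinM -muleA lee_pmul2l// 1?muleC// lte_fin.
Qed.

Theorem mainTheorem2 (R : realType) (N : nat) (hN : (3 <= N)%N)
    (T : R) (hT : 0 < T) (u : R -> R) (hu : piecewise_constant T u)
    (Ups : R -> Hbox R -> Hbox R) (hUps : is_propagator T u Ups)
    (X : R -> R -> Hbox R -> Hbox R) (hX : is_galerkin_propagator N T u X)
    (t : R) (ht : 0 <= t <= T) (j : nat) (hj : (1 <= j <= 3)%N) :
  ((normH (projH 3 (Ups t (phi R j)) - projH 3 (X t 0%R (phi R j))))%:E <=
   (\int[lebesgue_measure]_(tau in `[0%R, T]) `|u tau|%:E) *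
   (opnorm (fun psi => projH 3 (opB (psi - projH N psi)%R)) +
    2%:E * opnorm (@opB R) *
    ereal_sup [set opnorm (fun psi => projH 3 (X tau 0%R psi) -
                                      X tau 0%R (projH 3 psi))%R
              | tau in `[0%R, T]]))%E.
Proof.
have [U [hU Y0 YU]] := hUps.
have T0 : 0 <= T := ltW hT.
have itv0 : (0 : R) <= 0 <= T by rewrite lexx.
have pi0 : 0 <= pi :> R by rewrite ltW// pi_gt0.
set L1 : Hbox R -> Hbox R := fun psi => projH 3 (opB (psi - projH N psi)).
set S := ereal_sup _.
have opBZ (r : R) psi : opB (r%:C *: psi) = r%:C *: opB psi.
  have B0 : opB (0 : Hbox R) = 0.
    by apply: normH_eq0; apply/eqP; rewrite eq_le normH_ge0 andbT (le_trans (opB_bound _))// normH0 mulr0.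
  by rewrite -[r%:C *: psi]addr0 opBP B0 addr0.
have L1Z (r : R) psi : L1 (r%:C *: psi) = r%:C *: L1 psi.
  by rewrite /L1 projHZ -scalerBr opBZ projHZ.
have opB1 (psi : Hbox R) : normH psi <= 1 -> normH (opB psi) <= pi.
  by move=> h; apply: (le_trans (opB_bound psi)); exact: (ler_piMr pi0 h).
have fB := opnorm_fin opB1.
have L11 psi : normH psi <= 1 -> normH (L1 psi) <= pi.
  move=> h; apply: (le_trans (normH_projH _ _)); apply: opB1.
  exact: le_trans (normH_projHC _ _) h.
have fL := opnorm_fin L11.
have comm2 s psi : 0 <= s <= T -> normH psi <= 1 -> normH (commX 3 X s psi) <= 2.
  by move=> hs h; exact: (commX_le2 3 T0 hu hX (hU 0)).
have S_ge s : 0 <= s <= T -> (opnorm (commX 3 X s) <= S)%E.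
  by move=> hs; apply: ereal_sup_ubound; exists s => //=; rewrite in_itv.
have S0 : (0 <= S)%E := le_trans (opnorm_ge0 _) (S_ge 0 itv0).
(* All factors on the right are finite, so the estimate is one of real numbers. *)
have fS : S \is a fin_num.
  rewrite ge0_fin_numE//; apply: (@le_lt_trans _ _ 2%:E); last exact: ltry.
  apply: ge_ereal_sup => _ [s /= + <-]; rewrite in_itv/= => hs.
  by apply: opnorm_ub => psi; exact: comm2.
pose al := fine (opnorm L1); pose be := fine (opnorm (@opB R)); pose c := fine S.
have al0 : 0 <= al := fine_ge0 (opnorm_ge0 _).
have be0 : 0 <= be := fine_ge0 (opnorm_ge0 _).
have c0 : 0 <= c := fine_ge0 S0.
have hc s psi : 0 <= s <= T -> normH (commX 3 X s psi) <= c * normH psi.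
  move=> hs; have fC := opnorm_fin (fun psi => @comm2 s psi hs).
  apply: (le_trans (opnorm_le psi (fun r chi => commX_scale 3 T0 hu hX (hU 0) r chi hs) fC)).
  by rewrite ler_wpM2r ?normH_ge0// fine_le// S_ge.
set f := phi R j; set k := al + 2 * be * c.
have k0 : 0 <= k := addr_ge0 al0 (mulr_ge0 (mulr_ge0 (ler0n _ 2) be0) c0).
(* dl is the vector called Delta above, and y the solution through it. *)
set dl := projH 3 (Ups t f) - projH 3 (X t 0 f).
have Pdl : projH 3 dl = dl by rewrite /dl -projHB projH_id.
pose y s := X s t dl.
have sy : galerkin_solution N T u y := sol_X hX dl ht.
have yt : y t = dl := X_id hX dl ht.
have Py s : 0 <= s <= T -> projH N (y s) = y s.
  move=> hs; apply: (sol_projH (hU 0) hu sy ht hs).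
  by rewrite yt -Pdl projH_id.
have nf : normH f = 1.
  have h : normH f ^+ 2 = 1.
    by case/andP: hj => j0 _; rewrite normH_sqr /rdot phi_orthonormal// eqxx.
  by apply/eqP; rewrite -(@eqrXn2 _ 2)// ?normH_ge0// h expr1n.
have yK s psi : 0 <= s <= T -> normH psi <= 1 ->
    `|rdot (y s) (opB (psi - projH N psi))| <= normH dl * k.
  move=> hs h.
  apply: (le_trans (rdot_X_projH_le T0 hu hX (hU 0) hc _ hs ht Pdl)).
  apply: ler_wpM2l; first exact: normH_ge0.
  apply: lerD.
    apply: (le_trans (opnorm_le psi L1Z fL)).
    exact: (ler_piMr al0 h).
  apply: ler_wpM2r => //; apply: ler_wpM2l => //.
  apply: (le_trans (opnorm_le _ opBZ fB)); apply: (ler_piMr be0).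
  exact: le_trans (normH_projHC _ _) h.
have nf1 : normH f <= 1 by rewrite nf.
have PL := pairing_le hu hU Y0 YU sy Py yK nf1.
have [mT _] := PL T (introT andP (conj T0 (lexx T))).
have [_ le_t] := PL t ht.
have E : rdot (y t) (Ups t f) - rdot (y 0) f = normH dl * normH dl.
  have -> : rdot (y 0) f = rdot (y t) (X t 0 f).
    rewrite (sol_rdot (hU 0) hu sy (sol_X hX f itv0) itv0 ht).
    by rewrite (X_id hX f itv0).
  rewrite -rdotBr yt -expr2 normH_sqr -[in LHS]Pdl rdot_projH projHB.
  by [].
rewrite -(fineK fL) -(fineK fB) -(fineK fS) -!EFinM -EFinD.
apply: cancel_norm; [exact: normH_ge0|exact: k0|by apply: integral_ge0 => x _; rewrite lee_fin|].
rewrite -E; apply: (le_trans _ (y := ((normH dl * k)%:E *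
   \int[lebesgue_measure]_(x in `[0%R, t]) `|u x|%:E))%E).
  apply: (le_trans _ le_t); rewrite lee_fin; exact: ler_norm.
apply: lee_wpmul2l; first by rewrite lee_fin mulr_ge0 ?normH_ge0.
apply: ge0_subset_integral => //.
  by apply/measurable_EFinP; exact: measurableT_comp.
by apply: subset_itvl; rewrite bnd_simp; case/andP: ht.
Qed.
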